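(* Let $R$ be an associative ring with unity and let $n\ge3$ be an integer. Then the following exact sequences of pointed sets exist: (1) $$\mathrm K_{1,n}(R)\xrightarrow{\alpha}\pi_0(\mathrm{Um}_n(R))\xrightarrow{\beta}\mathrm K^s_{0,n-1}(R)\xrightarrow{\gamma}\mathrm K^s_{0,n}(R),$$ where the base point of $\mathrm K_{1,n}(R)$ is $[I_n]$ and the base point of $\pi_0(\mathrm{Um}_n(R))$ is $[e]$; (2) $$(\mathrm K_{2,n}(R))_2\xrightarrow{\delta}\mathrm K_{2,n}(R)\xrightarrow{\eta}\pi_1(\mathrm{EUm}_n(R))\xrightarrow{\mu}\mathrm K_{1,n-1}(R)/(\mathrm K_{1,n-1}(R))_2\xrightarrow{\lambda}\mathrm K_{1,n}(R).$$
   Context: **Groups.** $E_{ij}(r)=I_n+re_{ij}$ ($i\ne j$, $r\in R$); $\mathrm{E}_n(R)\subseteq\mathrm{GL}_n(R)$ is generated by these. $\mathrm{St}_n(R)$ is the Steinberg group with generators $X_{ij}(r)$ ($i\neq j$) and relations $X_{ij}(r)X_{ij}(s)=X_{ij}(r+s)$, $[X_{ij}(r),X_{kl}(s)]=1$ if $j\ne k,i\neq l$, $[X_{ij}(r),X_{jl}(s)]=X_{il}(rs)$ if $i\ne l$; $\theta_n:\mathrm{St}_n(R)\to\mathrm{GL}_n(R)$ sends $X_{ij}(r)$ to $E_{ij}(r)$. $J_n=\{(i,j):1\le i,j\le n,i\neq j\}$; $\alpha\subseteq J_n$ is nilpotent if $(i,j)\in\alpha\Rightarrow(j,i)\notin\alpha$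 and $(i,j),(j,k)\in\alpha\Rightarrow(i,k)\in\alpha$; $\Phi_n$ is the set of nilpotent subsets. $\mathrm{E}_n(R)_\alpha$ (resp. $\mathrm{St}_n(R)_\alpha$) is the subgroup generated by the $E_{ij}(r)$ (resp. $X_{ij}(r)$) with $(i,j)\in\alpha$. Put $e=(1,0,\ldots,0)$, $\mathrm{P}_n(R)=\{\sigma\in\mathrm{GL}_n(R):e\sigma=e\}$, $\mathrm{EP}_n(R)=\mathrm P_n(R)\cap\mathrm E_n(R)$, $\widetilde{P_n}(R)=\theta_n^{-1}(\mathrm{EP}_n(R))$. $(\mathrm{EP}_n(R))_2$ is the subgroup generated by all elements of $\mathrm{EP}_n(R)$ of the form $x^{-1}\varepsilon_\alpha\varepsilon_\beta x$ with $x\in\mathrm E_n(R)$, $\varepsilon_\alpha\in\mathrm E_n(R)_\alpha$, $\varepsilon_\beta\in \mathrm E_n(R)_\beta$, $\alpha,\beta\in\Phi_n$; $(\widetilde{P_n}(R))_2\subseteq\widetilde{P_n}(R)$ is defined analogously with $\mathrm{St}_n$ in place of $\mathrm E_n$. **K-objects.** $\mathrm K_{2,n}(R)=\ker\theta_n$; $(\mathrm K_{2,n}(R))_2=\mathrm K_{2,n}(R)\cap(\widetilde{P_n}(R))_2$. $\mathrm K_{1,m}(R)=\mathrm{GL}_m(R)/\mathrm E_m(R)$ (cosets $\sigma\mathrm E_m(R)$, base point $[I_m]$). $\mathrm{GL}_{n-1}(R)$ is embedded in $\mathrm{GL}_n(R)$ by $\tau\mapsto\begin{pmatrix}1&0\\0&\tau\end{pmatrix}$;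 $(\mathrm K_{1,n-1}(R))_2=(\mathrm{GL}_{n-1}(R)\cap(\mathrm{EP}_n(R))_2)/\mathrm E_{n-1}(R)$, and $\mathrm K_{1,n-1}(R)/(\mathrm K_{1,n-1}(R))_2$ is the set of cosets $\tau\,(\mathrm{GL}_{n-1}(R)\cap(\mathrm{EP}_n(R))_2)$, $\tau\in\mathrm{GL}_{n-1}(R)$, with base point the class of $I_{n-1}$. $\mathrm K^s_{0,m}(R)$ is the set of isomorphism classes of finitely generated projective modules $P$ such that $P\oplus R^r\simeq R^{m+r}$ for some $r$ (depending on $P$), with base point $[R^m]$. **Homotopy objects.** $\mathrm{Um}_n(R)$ is the set of rows $v\in R^n$ with $\sum_iv_iw_i=1$ for some $w\in R^n$, and $\mathrm{EUm}_n(R)=e\mathrm E_n(R)$. Both are global actions with local groups $\mathrm E_n(R)_\alpha$, $\alpha\in\Phi_n$, acting on the whole set by right multiplication. A local frame is a nonempty finite subset contained in a single orbit of a single local group. A path is a map $\omega$ from $\mathbb Z$ to the underlying set with each $\{\omega(m),\omega(m+1)\}$ a local frame, constant for $m\ll0$ (initial point) and for $m\gg0$ (terminal point). $\pi_0$ is the set of classes of points joined by paths (for $\mathrm{Um}_n(R)$ this is $\mathrm{Um}_n(R)/\mathrm E_n(R)$), with base point the class $[e]$. Two paths $\omega,\omega'$ are stably homotopic if there is a map $H$ on $\mathbb Z\times\mathbb Z$ sending each unit square $\{m,m+1\}\times\{k,k+1\}$ to a local frame, with each $H(\cdot,k)$ a path whose initial and terminal points do not depend on $k$, and $H(\cdot,k)=\omega$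 for $k\ll 0$, $=\omega'$ for $k\gg0$. $\pi_1(\mathrm{EUm}_n(R))$ is the group of stable homotopy classes of loops at $e$ under concatenation. It is identified with $\widetilde{P_n}(R)/(\widetilde{P_n}(R))_2$ by path lifting: a loop $e,eg_1,eg_1g_2,\ldots,eg_1\cdots g_N=e$ with $g_i\in\mathrm E_n(R)_{\alpha_i}$ corresponds to the class of $x_1\cdots x_N$, where $x_i\in\mathrm{St}_n(R)_{\alpha_i}$ is the unique element with $\theta_n(x_i)=g_i$. **Maps.** $\delta$ is the inclusion; $\eta(Y)=Y(\widetilde{P_n}(R))_2$; $\mu(Y(\widetilde{P_n}(R))_2)=[\theta_n(Y)_{rd}](\mathrm K_{1,n-1}(R))_2$, where $\sigma_{rd}=\tau$ for $\sigma=\begin{pmatrix}1&0\\ v&\tau\end{pmatrix}\in\mathrm{EP}_n(R)$; $\lambda$ sends the class of $\tau$ to $\begin{pmatrix}1&0\\0&\tau\end{pmatrix}\mathrm E_n(R)$; $\alpha(\sigma\mathrm{E}_n(R))=(e\sigma)\mathrm E_n(R)$; $\beta([v])=[\ker\beta_v]$, where $\beta_v:R^n\to R$, $\beta_v(w)=\sum_iv_iw_i$ (a map of right $R$-modules; projective modules here are right modules); $\gamma([P])=[P\oplus R]$. *)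

(* Defs.v *)
From HB Require Import structures.
From mathcomp Require Import all_boot all_order all_algebra.
From mathcomp Require Import boolp classical_sets functions cardinality.

Set Implicit Arguments.
Unset Strict Implicit.
Unset Printing Implicit Defensive.

Import GRing.Theory.
Local Open Scope classical_set_scope.
Local Open Scope ring_scope.

(* Quotients are sets of equivalence classes, so a pointed set is a subset of
   some ambient type with a base point; [pointed_map] asserts that the base points
   do lie in the subsets. The subsets are bare predicates because the universe of
   [set] is too small for classes of modules. *)
Record pset (T : Type) := PSet { pcarrier :> T -> Prop; pbase : T }.

Definition pointed_map T U (A : pset T) (B : pset U) (f : T -> U) : Prop :=
  [/\ A (pbase A), B (pbase B), forall a, A a -> B (f a) & f (pbase A) = pbase B].

Definition exact_at T U V (A : pset T) (B : pset U) (C : pset V)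
    (f : T -> U) (g : U -> V) : Prop :=
  forall b, B b -> (g b = pbase C <-> exists a, A a /\ f a = b).

Definition subgroup (G : groupType) (H : set G) : Prop :=
  [/\ H 1%g, forall x y, H x -> H y -> H (x * y)%g & forall x, H x -> H x^-1%g].

Definition generated (G : groupType) (S : set G) : set G := smallest (@subgroup G) S.

Definition gcoset (G : groupType) (x : G) (H : set G) : set G :=
  [set (x * h)%g | h in H].

Definition setprod (G : groupType) (A B : set G) : set G :=
  [set (p.1 * p.2)%g | p in A `*` B].

Section Presentation.
Variable I : choiceType.

(* The letter (i, false) is the generator i, the letter (i, true) its inverse. *)
Definition word := seq (I * bool).

Variable rel : word -> word -> Prop.

Inductive word_eq : word -> word -> Prop :=
| word_eq_refl w : word_eq w w
| word_eq_sym w w' : word_eq w w' -> word_eq w' w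
| word_eq_trans w w' w'' : word_eq w w' -> word_eq w' w'' -> word_eq w w''
| word_eq_cat u u' w w' :
    word_eq u u' -> word_eq w w' -> word_eq (u ++ w) (u' ++ w')
| word_eq_cancel i b : word_eq [:: (i, b); (i, ~~ b)] [::]
| word_eq_rel w w' : rel w w' -> word_eq w w'.

Definition word_eqb (w w' : word) : bool := `[< word_eq w w' >].

Lemma word_eqb_refl : reflexive word_eqb.
Proof. by move=> w; apply/asboolP; apply: word_eq_refl. Qed.

Lemma word_eqb_sym : symmetric word_eqb.
Proof. by move=> w w'; apply/asboolP/asboolP; apply: word_eq_sym. Qed.

Lemma word_eqb_trans : transitive word_eqb.
Proof.
move=> w w' w'' /asboolP h /asboolP h'.
by apply/asboolP; apply: word_eq_trans h'.
Qed.

Canonical word_equiv :=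
  EquivRel word_eqb word_eqb_refl word_eqb_sym word_eqb_trans.

Definition presented : Type := {eq_quot word_equiv}%qT.
HB.instance Definition _ := Choice.on presented.
HB.instance Definition _ := EqQuotient.on presented.

Definition pclass (w : word) : presented := (\pi_presented w)%qT.

Lemma pclassP w w' : pclass w = pclass w' <-> word_eq w w'.
Proof.
split=> [/eqP|h]; first by rewrite piE => /asboolP.
by apply/eqP; rewrite piE; apply/asboolP.
Qed.

Lemma repr_pclass w : word_eq (repr (pclass w)) w.
Proof. by apply/pclassP; rewrite /pclass reprK. Qed.

Lemma pclassK (x : presented) : pclass (repr x) = x.
Proof. exact: reprK. Qed.

Definition word_inv (w : word) : word := rev [seq (l.1, ~~ l.2) | l <- w].

Definition pmul (x y : presented) : presented := pclass (repr x ++ repr y).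
Definition pinv (x : presented) : presented := pclass (word_inv (repr x)).

Lemma pmulE u w : pmul (pclass u) (pclass w) = pclass (u ++ w).
Proof. by apply/pclassP/word_eq_cat; apply: repr_pclass. Qed.

Lemma word_invK w : word_inv (word_inv w) = w.
Proof.
rewrite /word_inv map_rev revK -map_comp -[RHS]map_id.
by apply: eq_map => -[i b] /=; rewrite negbK.
Qed.

Lemma word_mulV w : word_eq (w ++ word_inv w) [::].
Proof.
elim: w => [|[i b] w IH]; first exact: word_eq_refl.
have -> : ((i, b) :: w) ++ word_inv ((i, b) :: w) =
    [:: (i, b)] ++ ((w ++ word_inv w) ++ [:: (i, ~~ b)]).
  by rewrite /word_inv /= rev_cons -cats1 catA.
apply: word_eq_trans (word_eq_cancel i b).
apply: (word_eq_cat (word_eq_refl [:: (i, b)])).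
exact: (word_eq_cat IH (word_eq_refl _)).
Qed.

Lemma pmulA : associative pmul.
Proof.
move=> x y z; rewrite -[x]pclassK -[y]pclassK -[z]pclassK.
by rewrite !pmulE catA.
Qed.

Lemma pmul1 : left_id (pclass [::]) pmul.
Proof. by move=> x; rewrite -[x]pclassK pmulE. Qed.

Lemma pmulr1 : right_id (pclass [::]) pmul.
Proof. by move=> x; rewrite -[x]pclassK pmulE cats0. Qed.

Lemma pmulxV : right_inverse (pclass [::]) pinv pmul.
Proof.
by move=> x; rewrite -{1}[x]pclassK pmulE; apply/pclassP/word_mulV.
Qed.

Lemma pmulVx : left_inverse (pclass [::]) pinv pmul.
Proof.
move=> x; rewrite -{2}[x]pclassK pmulE; apply/pclassP.
by rewrite -{2}[repr x]word_invK; apply: word_mulV.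
Qed.

HB.instance Definition _ :=
  isGroup.Build presented pmulA pmul1 pmulr1 pmulVx pmulxV.

Definition pgen (i : I) : presented := pclass [:: (i, false)].

Section Lift.
Variables (G : groupType) (f : I -> G).

Definition word_eval (w : word) : G :=
  (\prod_(l <- w) (if l.2 then (f l.1)^-1 else f l.1))%g.

Hypothesis relf : forall w w', rel w w' -> word_eval w = word_eval w'.

Lemma word_eval_cat u w : word_eval (u ++ w) = (word_eval u * word_eval w)%g.
Proof. by rewrite /word_eval big_cat. Qed.

Lemma word_eval_eq w w' : word_eq w w' -> word_eval w = word_eval w'.
Proof.
elim=> {w w'} [//|//|w w' w'' _ -> _ -> //|u u' w w' _ + _|i b|w w' /relf //].
  by rewrite !word_eval_cat => -> ->.
rewrite /word_eval !big_cons big_nil /= mulg1.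
by case: b; rewrite /= ?mulgV ?mulVg.
Qed.

Definition plift (x : presented) : G := word_eval (repr x).

Lemma plift_gen i : plift (pgen i) = f i.
Proof.
by rewrite /plift (word_eval_eq (repr_pclass _)) /word_eval big_seq1.
Qed.

Lemma pliftM : {morph plift : x y / (x * y)%g}.
Proof.
by move=> x y; rewrite /plift (word_eval_eq (repr_pclass _)) word_eval_cat.
Qed.

End Lift.
End Presentation.

Section GL.
Variables (R : pzRingType) (n : nat).

Definition mx_invertible (A : 'M[R]_n) : Prop :=
  exists B : 'M[R]_n, A *m B = 1%:M /\ B *m A = 1%:M.

Record GL := MkGL { GLval :> 'M[R]_n ; GLvalP : `[< mx_invertible GLval >] }.
HB.instance Definition _ := [isSub for GLval].
HB.instance Definition _ := [Choice of GL by <:].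

Lemma GL_inj : injective GLval. Proof. exact: val_inj. Qed.

Lemma GL1_subproof : `[< mx_invertible 1%:M >].
Proof. by apply/asboolP; exists 1%:M; rewrite mulmx1. Qed.

Lemma GLM_subproof (g h : GL) : `[< mx_invertible (g *m h) >].
Proof.
case: g h => [A /asboolP[A' [AA' A'A]]] [B /asboolP[B' [BB' B'B]]] /=.
apply/asboolP; exists (B' *m A'); split.
  by rewrite mulmxA -(mulmxA A) BB' mulmx1.
by rewrite mulmxA -(mulmxA B') A'A mulmx1.
Qed.

Definition GLinvmx (g : GL) : 'M[R]_n := projT1 (cid (asboolW (GLvalP g))).

Lemma GLmulmxV (g : GL) : g *m GLinvmx g = 1%:M.
Proof. by rewrite /GLinvmx; case: cid => B []. Qed.

Lemma GLmulVmx (g : GL) : GLinvmx g *m g = 1%:M.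
Proof. by rewrite /GLinvmx; case: cid => B []. Qed.

Lemma GLV_subproof (g : GL) : `[< mx_invertible (GLinvmx g) >].
Proof. by apply/asboolP; exists g; rewrite GLmulmxV GLmulVmx. Qed.

Definition GLone : GL := MkGL GL1_subproof.
Definition GLmul (g h : GL) : GL := MkGL (GLM_subproof g h).
Definition GLinv (g : GL) : GL := MkGL (GLV_subproof g).

Lemma GLmulA : associative GLmul.
Proof. by move=> f g h; apply: GL_inj; apply: mulmxA. Qed.

Lemma GLmul1 : left_id GLone GLmul.
Proof. by move=> g; apply: GL_inj; apply: mul1mx. Qed.

Lemma GLmulr1 : right_id GLone GLmul.
Proof. by move=> g; apply: GL_inj; apply: mulmx1. Qed.

Lemma GLmulVx : left_inverse GLone GLinv GLmul.
Proof. by move=> g; apply: GL_inj; apply: GLmulVmx. Qed.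

Lemma GLmulxV : right_inverse GLone GLinv GLmul.
Proof. by move=> g; apply: GL_inj; apply: GLmulmxV. Qed.

HB.instance Definition _ := isGroup.Build GL GLmulA GLmul1 GLmulr1 GLmulVx GLmulxV.

End GL.

Definition offdiag (n : nat) : {set 'I_n * 'I_n} := [set ij | ij.1 != ij.2].

Definition nilpotent_set n (a : {set 'I_n * 'I_n}) : Prop :=
  [/\ a \subset offdiag n,
      forall i j, (i, j) \in a -> (j, i) \notin a
    & forall i j k, (i, j) \in a -> (j, k) \in a -> (i, k) \in a].

Section Steinberg.
Variables (R : pzRingType) (n : nat).

Definition elem_mx (i j : 'I_n) (r : R) : 'M[R]_n := 1%:M + r *: delta_mx i j.

Lemma scale_delta_mxM (i j k l : 'I_n) (r s : R) :
  (r *: delta_mx i j) *m (s *: delta_mx k l)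
    = (if j == k then r * s else 0) *: delta_mx i l :> 'M[R]_n.
Proof.
apply/matrixP => a b; rewrite !mxE (bigD1 j) //= big1 ?addr0 => [|h hj].
  rewrite !mxE eqxx andbT.
  by case: (a == i); case: (j == k); case: (b == l);
     rewrite ?mulr1 ?mulr0 ?mul0r ?mulr0.
by rewrite !mxE (negbTE hj) andbF mulr0 mul0r.
Qed.

Lemma elem_mxM i j (r s : R) : i != j ->
  elem_mx i j r *m elem_mx i j s = elem_mx i j (r + s).
Proof.
move=> ij; rewrite /elem_mx mulmxDl mul1mx mulmxDr mulmx1 scale_delta_mxM.
by rewrite eq_sym (negbTE ij) scale0r addr0 -addrA [_ *: _ + _]addrC -scalerDl.
Qed.

Lemma elem_mx_subproof i j (ij : i != j) (r : R) :
  `[< mx_invertible (elem_mx i j r) >].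
Proof.
have e0 : elem_mx i j 0 = 1%:M by rewrite /elem_mx scale0r addr0.
apply/asboolP; exists (elem_mx i j (- r)).
by rewrite !elem_mxM // addrN addNr e0.
Qed.

Definition elem i j (ij : i != j) (r : R) : GL R n := MkGL (elem_mx_subproof ij r).

(* The generator X_ij(r) is indexed by ((i, j), r) with i != j. *)
Definition st_index : Type := ({ij : 'I_n * 'I_n | ij.1 != ij.2} * R)%type.
HB.instance Definition _ := Choice.on st_index.

Definition st_letter i j (ij : i != j) (r : R) (b : bool) : st_index * bool :=
  ((Sub (i, j) ij, r), b).

Local Notation x := st_letter (only parsing).

(* The commutator is [a, b] = a b a^-1 b^-1. *)
Inductive st_rel : word st_index -> word st_index -> Prop :=
| st_rel_add i j (ij : i != j) r s :
    st_rel [:: x ij r false; x ij s false] [:: x ij (r + s) false]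
| st_rel_comm i j k l (ij : i != j) (kl : k != l) r s :
    j != k -> i != l ->
    st_rel [:: x ij r false; x kl s false; x ij r true; x kl s true] [::]
| st_rel_mul i j l (ij : i != j) (jl : j != l) (il : i != l) r s :
    st_rel [:: x ij r false; x jl s false; x ij r true; x jl s true]
           [:: x il (r * s) false].

Definition St : Type := presented st_rel.
HB.instance Definition _ := Group.on St.

Definition stX i j (ij : i != j) (r : R) : St := pgen st_rel (Sub (i, j) ij, r).

Lemma elem_rel (w w' : word st_index) : st_rel w w' ->
  word_eval (fun g : st_index => elem (valP g.1) g.2) w =
  word_eval (fun g : st_index => elem (valP g.1) g.2) w'.
Proof.
case=> [i j ij r s|i j k l ij kl r s jk il|i j l ij jl il r s];
  rewrite /word_eval !big_cons !big_nil /= !mulg1.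
- by apply: GL_inj; apply: elem_mxM.
- rewrite !mulgA; apply/eqP; rewrite -mulgA -invgM divg_eq1; apply/eqP.
  apply: GL_inj; rewrite /= /elem_mx !mulmxDl !mulmxDr !mul1mx !mulmx1.
  rewrite !scale_delta_mxM (negbTE jk) [l == i]eq_sym (negbTE il) !scale0r.
  by rewrite !addr0 -!addrA [_ *: _ + _]addrC.
rewrite !mulgA -mulgA -invgM; apply/eqP; rewrite divg_eq; apply/eqP.
apply: GL_inj; rewrite /= /elem_mx !mulmxDl !mulmxDr !mul1mx !mulmx1.
rewrite !scale_delta_mxM eqxx [l == i]eq_sym (negbTE il) !scale0r.
by rewrite [l == j]eq_sym (negbTE jl) !scale0r !addr0 -!addrA;
  congr (_ + _); rewrite addrCA.
Qed.

Definition theta : St -> GL R n :=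
  plift (fun g : st_index => elem (valP g.1) g.2).

Lemma thetaX i j (ij : i != j) r : theta (stX ij r) = elem ij r.
Proof. by rewrite /theta plift_gen; [apply: GL_inj | apply: elem_rel]. Qed.

Lemma thetaM : {morph theta : x y / (x * y)%g}.
Proof. exact: (pliftM elem_rel). Qed.

Definition En : set (GL R n) :=
  generated [set g | exists i j (ij : i != j) r, g = elem ij r].

Definition En_local (a : {set 'I_n * 'I_n}) : set (GL R n) :=
  generated [set g | exists i j (ij : i != j) r, (i, j) \in a /\ g = elem ij r].

Definition St_local (a : {set 'I_n * 'I_n}) : set St :=
  generated [set y | exists i j (ij : i != j) r, (i, j) \in a /\ y = stX ij r].

End Steinberg.

Arguments En R n : clear implicits.
Arguments En_local R {n} a _.
Arguments St_local R {n} a _.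

(* The subgroup generated by the elements of K of the form x^-1 y z x with x in
   H and y, z in local subgroups indexed by nilpotent sets. *)
Definition gen2 (G : groupType) n (loc : {set 'I_n * 'I_n} -> set G)
    (H K : set G) : set G :=
  generated [set g | K g /\ exists x y z a b,
    [/\ H x, nilpotent_set a, loc a y, nilpotent_set b & loc b z] /\
    g = (x^-1 * (y * z) * x)%g].

Section KGroups.
Variables (R : pzRingType) (m : nat).

Definition e1row : 'rV[R]_m.+1 := delta_mx 0 0.

Definition Pn : set (GL R m.+1) := [set s | e1row *m s = e1row].
Definition EPn : set (GL R m.+1) := Pn `&` En R m.+1.
Definition Pt : set (St R m.+1) := @theta R m.+1 @^-1` EPn.

Definition EPn2 : set (GL R m.+1) := gen2 (En_local R) (En R m.+1) EPn.
Definition Pt2 : set (St R m.+1) := gen2 (St_local R) setT Pt.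

Lemma embed_subproof (t : GL R m) :
  `[< mx_invertible (lift0_mx t : 'M[R]_m.+1) >].
Proof.
apply/asboolP; exists (lift0_mx (GLinvmx t)).
have e1 : 1%:M = block_mx 1 0 0 1%:M :> 'M[R]_(1 + m).
  by rewrite [LHS]scalar_mx_block.
by split; rewrite -[m.+1]/(1 + m)%N e1 /lift0_mx mulmx_block !mulmx0 !mul0mx
  !addr0 !add0r mulmx1 ?GLmulmxV ?GLmulVmx.
Qed.

Definition embed (t : GL R m) : GL R m.+1 := MkGL (embed_subproof t).

Definition K1 (n : nat) : pset (set (GL R n)) :=
  PSet (range (fun s => gcoset s (En R n))) (gcoset 1%g (En R n)).

Definition GLEP2 : set (GL R m) := embed @^-1` EPn2.

(* GLEP2 contains En R m, so this is K_1 modulo the subset GLEP2 / En R m. *)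
Definition K1_mod_K12 : pset (set (GL R m)) :=
  PSet (range (fun t => gcoset t GLEP2)) (gcoset 1%g GLEP2).

Definition K2 : pset (St R m.+1) :=
  PSet [set y | @theta R m.+1 y = 1%g] 1%g.

Definition K22 : pset (St R m.+1) := PSet (pcarrier K2 `&` Pt2) 1%g.

Definition Pt_quot : set (set (St R m.+1)) := [set gcoset y Pt2 | y in Pt].

End KGroups.

(* A right R-module is a left module over the converse ring R^c: on 'cV[R^c]_n
   the scalar action a *: w is w_i * a entrywise, with the product taken in R. *)

Section Modules.
Variable R : pzRingType.

Definition isom (M N : lmodType R^c) : Prop :=
  exists f : {linear M -> N}, bijective f.

Definition module_class : Type := lmodType R^c -> Prop.

Definition iso_class (M : lmodType R^c) : module_class := fun N => isom M N.

Definition finitely_generated (M : lmodType R^c) : Prop :=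
  exists k (f : {linear 'cV[R^c]_k -> M}), forall y, exists x, f x = y.

Definition projective (M : lmodType R^c) : Prop :=
  forall (A B : lmodType R^c) (g : {linear A -> B}) (f : {linear M -> B}),
    (forall y, exists x, g x = y) ->
    exists h : {linear M -> A}, forall x, g (h x) = f x.

Definition stably_free (k : nat) (M : lmodType R^c) : Prop :=
  exists r, isom (M * 'cV[R^c]_r)%type 'cV[R^c]_(k + r).

Definition K0s_module (k : nat) (M : lmodType R^c) : Prop :=
  [/\ finitely_generated M, projective M & stably_free k M].

Definition K0s (k : nat) : pset module_class :=
  PSet (fun C => exists M, K0s_module k M /\ iso_class M = C)
       (iso_class 'cV[R^c]_k).

Section Kernel.
Variables (n : nat) (v : 'rV[R]_n).

Definition row_form (w : 'cV[R^c]_n) : R := \sum_i (v 0 i : R) * (w i 0 : R).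

Definition ker_pred : {pred 'cV[R^c]_n} := fun w => row_form w == 0.

Lemma ker_submod_closed : submod_closed ker_pred.
Proof.
rewrite /ker_pred; split=> [|a x y /eqP x0 /eqP y0]; rewrite unfold_in /row_form.
  by rewrite big1 // => i _; rewrite mxE mulr0.
have -> : \sum_i (v 0 i : R) * ((a *: x + y) i 0 : R)
    = row_form x * (a : R) + row_form y.
  rewrite /row_form mulr_suml -big_split /=; apply: eq_bigr => i _.
  by rewrite !mxE mulrDr mulrA.
by rewrite x0 y0 mul0r addr0.
Qed.

HB.instance Definition _ :=
  GRing.isSubmodClosed.Build R^c 'cV[R^c]_n ker_pred ker_submod_closed.

Record ker_row := KerRow { ker_val :> 'cV[R^c]_n; _ : ker_val \in ker_pred }.
HB.instance Definition _ := [isSub for ker_val].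
HB.instance Definition _ := [Choice of ker_row by <:].
HB.instance Definition _ := [SubChoice_isSubLmodule of ker_row by <:].

End Kernel.
End Modules.

Section GlobalAction.
Variables (R : pzRingType) (n : nat).
Local Notation row := 'rV[R]_n.

(* The underlying set, on which the groups En_local a act on the right. *)
Variable U : set row.

Definition ga_orbit (v : row) (a : {set 'I_n * 'I_n}) : set row :=
  [set v *m g | g in En_local R a].

Definition local_frame (F : set row) : Prop :=
  [/\ F !=set0, finite_set F, F `<=` U &
      exists v a, [/\ U v, nilpotent_set a & F `<=` ga_orbit v a]].

Definition ga_path (x y : row) (w : int -> row) : Prop :=
  [/\ forall k : int, local_frame [set w k; w (k + 1)],
      exists k0, forall k : int, k <= k0 -> w k = x
    & exists k1, forall k : int, k1 <= k -> w k = y].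

Definition pi0_class (x : row) : set row :=
  [set y | U y /\ exists w, ga_path x y w].

Definition pi0 (x0 : row) : pset (set row) :=
  PSet [set pi0_class x | x in U] (pi0_class x0).

Definition stably_homotopic (w w' : int -> row) : Prop :=
  exists H : int -> int -> row,
  [/\ forall j k : int,
        local_frame [set H p.1 p.2 | p in [set j; j + 1] `*` [set k; k + 1]],
      exists x y, forall k, ga_path x y (H ^~ k),
      exists k0, forall k : int, k <= k0 -> H ^~ k = w
    & exists k1, forall k : int, k1 <= k -> H ^~ k = w'].

Definition loop (x0 : row) : set (int -> row) := ga_path x0 x0.

Definition loop_class (x0 : row) (w : int -> row) : set (int -> row) :=
  [set w' | loop x0 w' /\ stably_homotopic w w'].

Definition pi1 (x0 : row) : pset (set (int -> row)) :=
  PSet [set loop_class x0 w | w in loop x0] (loop_class x0 (fun=> x0)).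

(* w'' runs through w, up to a time after which w is constant, and then through
   w', from a time before which w' is constant. *)
Definition concatenation (x0 : row) (w w' w'' : int -> row) : Prop :=
  exists j k : int,
  [/\ forall i : int, j <= i -> w i = x0, forall i : int, i <= k -> w' i = x0,
      forall i : int, i <= j -> w'' i = w i
    & forall i : int, j <= i -> w'' i = w' (i - j + k)].

Definition pi1_mul (x0 : row) (A B : set (int -> row)) : set (int -> row) :=
  [set z | exists w w' w'', [/\ A w, B w', concatenation x0 w w' w''
                              & loop_class x0 w'' z]].

End GlobalAction.

Section Unimodular.
Variable R : pzRingType.

Definition Um n : set 'rV[R]_n :=
  [set v | exists w : 'I_n -> R, \sum_i v 0 i * w i = 1].

Variable m : nat.

Definition EUm : set 'rV[R]_m.+1 := [set e1row R m *m g | g in En R m.+1].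

(* xs = [:: x_1; ...; x_N] lifts the loop w: up to a translation of time, w is
   the sequence e, e g_1, e g_1 g_2, ..., e g_1 ... g_N with g_i = theta x_i. *)
Definition lifts (w : int -> 'rV[R]_m.+1) (xs : seq (St R m.+1)) : Prop :=
  (forall x, x \in xs -> exists a, nilpotent_set a /\ St_local R a x) /\
  exists k0 : int,
    (forall k : int, k <= k0 -> w k = e1row R m) /\
    (forall k : nat, w (k0 + k%:Z) =
       e1row R m *m theta (\prod_(x <- take k xs) x)%g).

End Unimodular.

Arguments Um R n _ : clear implicits.
Arguments EUm R m _ : clear implicits.
Arguments Pt R m _ : clear implicits.
Arguments Pt2 R m _ : clear implicits.
Arguments Pt_quot R m _ : clear implicits.
Arguments GLEP2 R m _ : clear implicits.

(* Main.v *)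
Require Import Defs.
From HB Require Import structures.
From mathcomp Require Import all_boot all_order all_algebra.
From mathcomp Require Import zify.
From mathcomp Require Import boolp classical_sets functions cardinality.

Set Implicit Arguments.
Unset Strict Implicit.
Unset Printing Implicit Defensive.

Import Order.TTheory GRing.Theory Num.Theory.
Local Open Scope classical_set_scope.
Local Open Scope ring_scope.

(** Both sequences come from one kind of bookkeeping: an isomorphism or a path is
    replaced by the matrix, or the Steinberg element, that realizes it.

    First sequence. If v w = 1 then R^n is the direct sum of ker v and of the free
    line wR ([isom_ker_row_split]); conversely a decomposition of R^n as P + R is
    given by a unimodular row with kernel P, namely the second projection
    ([ker_row_of_split]). Hence the kernels of unimodular rows are exactly the
    modules P with P + R free of rank n, which is exactness at K_0^s. A basis of
    ker v together with w is a basis of R^n, in which v is the first coordinate; so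
    ker v is free of rank n - 1 exactly when v is the first row of an invertible
    matrix ([completable_of_free_ker]), which is exactness at pi_0. A path changes v
    by an elementary matrix, and these act on kernels by isomorphisms.

    Second sequence. Its heart is the identification of pi_1 with Pt / Pt2. Write
    e for the first basis row; a point of the orbit of e is e theta(g) with g in the
    Steinberg group, and an edge is right multiplication of g by an element of a
    local subgroup. That element is not determined by the edge, but two choices
    differ by a spur g y z g^-1, an edge travelled along y and back along z, and Pt2
    is by definition generated by the spurs. So the classes Pt2 g form a covering in
    which edges lift uniquely. All four edges of a square can be lifted inside the
    same local subgroup, so squares lift as well ([ladder_lift]) and homotopic loops
    have the same end point modulo Pt2 ([homotopic_lift]).

    For the converse, a path is coded by the list of the local elements which it
    multiplies by. Merging two neighbouring elements of the same local subgroup is a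
    homotopy ([move_merge]). The roots in each Steinberg relation lie in one
    nilpotent set ([st_rel_local]), so every relation is a composite of
    merges, and the homotopy class of a path depends only on the product of its list
    ([move_prod]). A spur can be inserted freely, because the points of the path do
    not notice whether it returns along z or along y^-1 ([Pt2_walk]). Together,
    loops whose lifts agree modulo Pt2 are homotopic ([lift_homotopic]).

    The rest is group theory in the stabilizer of e. It consists of the lower block
    triangular matrices with corner 1, and each of them is a block diagonal
    matrix times a matrix with a single nontrivial column ([Pn_factor]). The latter
    lies in a local subgroup fixing e, hence in (EP)_2, so passing to the corner t
    loses nothing modulo (EP)_2; and theta maps Pt2 onto (EP)_2 ([theta_Pt2]), so a
    corner in (EP)_2 can be corrected to an element of K_2. *)

(** * Isomorphism classes of modules *)

Section Isom.
Variable R : pzRingType.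
Implicit Types M N P : lmodType R^c.

Lemma linear_fun M N (f : M -> N) : linear f ->
  exists g : {linear M -> N}, forall x, g x = f x.
Proof.
move=> lf.
pose F := GRing.isLinear.Build R^c M N _ f lf.
pose g : {linear M -> N} := HB.pack f F.
by exists g.
Qed.

Lemma isomI M N (f : M -> N) (g : N -> M) :
  linear f -> cancel f g -> cancel g f -> isom M N.
Proof.
move=> /linear_fun[h hf] fK gK; exists h.
by exists g => x; rewrite hf ?fK ?gK.
Qed.

Lemma isomE M N : isom M N -> exists (f : {linear M -> N}) (g : {linear N -> M}),
  cancel f g /\ cancel g f.
Proof.
move=> [f [g fK gK]].
have [|h hE] := @linear_fun N M g.
  move=> a x y; apply: (can_inj fK).
  by rewrite linearP !gK.
by exists f, h; split=> x; rewrite hE ?fK ?gK.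
Qed.

Lemma isom_refl M : isom M M.
Proof. exact: (@isomI _ _ id id). Qed.

Lemma isom_sym M N : isom M N -> isom N M.
Proof. by move=> /isomE[f [g [fK gK]]]; exists g; exists f. Qed.

Lemma isom_trans M N P : isom M N -> isom N P -> isom M P.
Proof.
move=> [f [f' fK f'K]] [g [g' gK g'K]].
apply: (@isomI _ _ (g \o f) (f' \o g')) => [a x y|x|x] /=.
- by rewrite !linearP.
- by rewrite gK fK.
- by rewrite f'K g'K.
Qed.

Lemma iso_classP M N : iso_class M = iso_class N <-> isom M N.
Proof.
split=> [h|MN].
  by have : iso_class N N := isom_refl N; rewrite -h.
apply/funext => P; apply/propext; rewrite /iso_class; split; apply: isom_trans => //.
exact: isom_sym.
Qed.

Lemma isom_prod M M' N N' : isom M M' -> isom N N' ->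
  isom (M * N)%type (M' * N')%type.
Proof.
move=> [f [f' fK f'K]] [g [g' gK g'K]].
apply: (@isomI _ _ (fun p => (f p.1, g p.2)) (fun p => (f' p.1, g' p.2))).
- by move=> a [x1 x2] [y1 y2] /=; rewrite !linearP.
- by move=> [x y] /=; rewrite fK gK.
- by move=> [x y] /=; rewrite f'K g'K.
Qed.

Lemma isom_prodAC M N P : isom (M * N * P)%type (M * P * N)%type.
Proof.
apply: (@isomI _ _ (fun p => (p.1.1, p.2, p.1.2)) (fun p => (p.1.1, p.2, p.1.2))).
- by move=> a [[x1 x2] x3] [[y1 y2] y3].
- by case=> [[]].
- by case=> [[]].
Qed.

Lemma isom_col_regular : isom (R^c)^o 'cV[R^c]_1.
Proof.
apply: (@isomI _ _ (fun a : (R^c)^o => (const_mx (a : R^c) : 'cV[R^c]_1))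
                   (fun u : 'cV[R^c]_1 => (u 0 0 : (R^c)^o))).
- by move=> a x y; apply/matrixP => i j; rewrite !mxE.
- by move=> x; rewrite mxE.
- by move=> x; apply/matrixP => i j; rewrite !mxE !ord1.
Qed.

Lemma isom_col_prod k l : isom ('cV[R^c]_k * 'cV[R^c]_l)%type 'cV[R^c]_(k + l).
Proof.
apply: (@isomI _ _ (fun p => col_mx p.1 p.2) (fun u => (usubmx u, dsubmx u))).
- by move=> a [x1 x2] [y1 y2] /=; rewrite scale_col_mx add_col_mx.
- by move=> [x y]; rewrite /= col_mxKu col_mxKd.
- by move=> x; rewrite /= vsubmxK.
Qed.

Lemma isom_col_regular_prod k : isom ('cV[R^c]_k * (R^c)^o)%type 'cV[R^c]_k.+1.
Proof.
rewrite -[k.+1]addn1; apply: isom_trans (isom_col_prod k 1).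
exact: isom_prod (isom_refl _) isom_col_regular.
Qed.

Lemma stably_free_regular k M :
  stably_free k M -> stably_free k.+1 (M * (R^c)^o)%type.
Proof.
move=> [r h]; exists r; apply: isom_trans (isom_prodAC _ _ _) _.
by apply: isom_trans (isom_prod h (isom_refl _)) (isom_col_regular_prod _).
Qed.

Lemma stably_free_of_prod_regular k M :
  isom (M * (R^c)^o)%type 'cV[R^c]_k.+1 -> stably_free k M.
Proof.
move=> h; exists 1%N; rewrite (addn1 k); apply: isom_trans h.
exact: isom_prod (isom_refl _) (isom_sym isom_col_regular).
Qed.

Lemma stably_free_free k : stably_free k 'cV[R^c]_k.
Proof. by exists 0%N; apply: isom_col_prod. Qed.

Lemma col_sum k (u : 'cV[R^c]_k) : u = \sum_i u i 0 *: delta_mx i 0.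
Proof.
apply/colP => i; rewrite summxE (bigD1 i) //= big1 => [|j ji].
  by rewrite !mxE !eqxx mulr1 addr0.
by rewrite !mxE eq_sym (negbTE ji) mulr0.
Qed.

Lemma col_projective k : projective 'cV[R^c]_k.
Proof.
move=> A B g f gs.
have [a ga] := choice (fun i : 'I_k => gs (f (delta_mx i 0))).
have [|h hE] := @linear_fun 'cV[R^c]_k A (fun u => \sum_i u i 0 *: a i).
  move=> c x y; rewrite scaler_sumr -big_split; apply: eq_bigr => i _ /=.
  by rewrite !mxE scalerDl scalerA.
exists h => u; rewrite hE {2}(col_sum u) !linear_sum; apply: eq_bigr => i _.
by rewrite !linearZ ga.
Qed.

(** A stably free module is a direct summand of a free module of finite rank, so
    the other two conditions come for free. *)
Lemma K0s_moduleE k M : K0s_module k M <-> stably_free k M.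
Proof.
split=> [[]//|sf]; split=> //; have [r /isomE[f [g [fK gK]]]] := sf.
  have [|h hE] := @linear_fun 'cV[R^c]_(k + r) M (fun u => (g u).1).
    by move=> a x y; rewrite linearP.
  by exists (k + r)%N, h => y; exists (f (y, 0)); rewrite hE fK.
move=> A B p q ps.
have [|q' q'E] := @linear_fun 'cV[R^c]_(k + r) B (fun u => q (g u).1).
  by move=> a x y; rewrite !linearP.
have [h hE] := @col_projective (k + r) A B p q' ps.
have [|h' h'E] := @linear_fun M A (fun x => h (f (x, 0))).
  move=> a x y; rewrite -!linearP; congr (h (f _)).
  by rewrite -[LHS]/((a *: x + y)%R, 0) -[RHS]/(a *: x + y, a *: 0 + 0) scaler0 addr0.
by exists h' => x; rewrite h'E hE q'E fK.
Qed.

End Isom.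

(** * Kernels of unimodular rows *)

Section RowKernel.
Variables (R : pzRingType) (n : nat).
Implicit Types (v : 'rV[R]_n) (u w : 'cV[R^c]_n).

Lemma row_form_linear v : linear (row_form v : 'cV[R^c]_n -> (R^c)^o).
Proof.
move=> a x y; rewrite /row_form.
rewrite -[RHS]/((\sum_i (v 0 i : R) * (x i 0 : R)) * (a : R) + row_form v y).
rewrite /row_form mulr_suml -big_split /=; apply: eq_bigr => i _.
by rewrite !mxE mulrDr mulrA.
Qed.

Lemma ker_rowP v (k : ker_row v) : row_form v (ker_val k) = 0.
Proof. exact: (eqP (valP k)). Qed.

Lemma row_formD v x y : row_form v (x + y) = row_form v x + row_form v y.
Proof. by have := row_form_linear v 1 x y; rewrite !scale1r. Qed.

Lemma row_formZ v (a : R^c) x : row_form v (a *: x) = row_form v x * (a : R).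
Proof.
by rewrite /row_form mulr_suml; apply: eq_bigr => i _; rewrite !mxE mulrA.
Qed.

Lemma row_formN v x : row_form v (- x) = - row_form v x.
Proof.
by rewrite /row_form -sumrN; apply: eq_bigr => i _; rewrite !mxE mulrN.
Qed.

Lemma row_form_delta v i : row_form v (delta_mx i 0) = v 0 i.
Proof.
rewrite /row_form (bigD1 i) //= big1 => [|j /negbTE ji].
  by rewrite mxE !eqxx mulr1 addr0.
by rewrite mxE ji mulr0.
Qed.

Lemma row_form_mulmx v (g : 'M[R]_n) u :
  row_form (v *m g) u = row_form v (g *m (u : 'cV[R]_n)).
Proof.
rewrite -[LHS]/(\sum_i (v *m g) 0 i * (u i 0 : R)).
transitivity ((v *m g *m (u : 'cV[R]_n)) 0 0); first by rewrite [RHS]mxE.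
by rewrite -mulmxA mxE.
Qed.

Lemma mulmx_col_linear k (B : 'M[R]_(k, n)) :
  linear (fun u : 'cV[R^c]_n => (B *m (u : 'cV[R]_n) : 'cV[R^c]_k)).
Proof.
move=> a x y; apply/colP => i; rewrite !mxE.
rewrite -[RHS]/((\sum_j B i j * (x j 0 : R)) * (a : R) +
  (\sum_j B i j * (y j 0 : R))).
rewrite mulr_suml -big_split /=; apply: eq_bigr => j _.
by rewrite !mxE mulrDr mulrA.
Qed.

Lemma isom_ker_row_mulmx v (g : GL R n) :
  isom (ker_row (v *m g)) (ker_row v).
Proof.
have gP (k : ker_row (v *m g)) :
    (g *m (ker_val k : 'cV[R]_n) : 'cV[R^c]_n) \in ker_pred v.
  by apply/eqP; rewrite -row_form_mulmx ker_rowP.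
have gVP (k : ker_row v) :
    (GLinvmx g *m (ker_val k : 'cV[R]_n) : 'cV[R^c]_n) \in ker_pred (v *m g).
  by apply/eqP; rewrite row_form_mulmx mulmxA GLmulmxV mul1mx ker_rowP.
apply: (@isomI _ _ _ (fun k => KerRow (gP k)) (fun k => KerRow (gVP k))).
- by move=> a x y; apply: val_inj; apply: mulmx_col_linear.
- by move=> x; apply: val_inj; rewrite /= mulmxA GLmulVmx mul1mx.
- by move=> x; apply: val_inj; rewrite /= mulmxA GLmulmxV mul1mx.
Qed.

(** A vector w with v w = 1 splits the form of v: each u is the sum of
    u - w (v u), which lies in the kernel, and of w (v u). *)
Lemma isom_ker_row_split v : Um R n v ->
  isom (ker_row v * (R^c)^o)%type 'cV[R^c]_n.
Proof.
move=> [c vc]; pose w : 'cV[R^c]_n := \col_i (c i : R^c).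
have vw : row_form v w = 1.
  by rewrite -vc; apply: eq_bigr => i _; rewrite mxE.
have P u : u - (row_form v u : R^c) *: w \in ker_pred v.
  by apply/eqP; rewrite row_formD row_formN row_formZ vw mul1r subrr.
apply: (@isomI _ _ _ (fun p : ker_row v * (R^c)^o => ker_val p.1 + (p.2 : R^c) *: w)
   (fun u => (KerRow (P u), row_form v u : (R^c)^o))).
- move=> a [x1 x2] [y1 y2].
  rewrite -[LHS]/(ker_val (a *: x1 + y1) + ((a * x2 : R^c) + y2) *: w).
  rewrite -[ker_val _]/(a *: ker_val x1 + ker_val y1) /=.
  by rewrite scalerDr scalerA scalerDl addrACA.
- move=> [x y] /=.
  have e : row_form v (ker_val x + (y : R^c) *: w) = y.
    by rewrite row_formD row_formZ vw mul1r ker_rowP add0r.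
  congr (_, _) => //; apply: val_inj; rewrite /= e addrK //.
- by move=> u /=; rewrite subrK.
Qed.

(** The projection of P + R to R, read on R^n, is a linear form, hence the form of
    a row; it takes the value 1 at the image of (0, 1), and its kernel is P. *)
Lemma ker_row_of_split (P : lmodType R^c) :
  isom (P * (R^c)^o)%type 'cV[R^c]_n ->
  exists v, Um R n v /\ isom (ker_row v) P.
Proof.
move=> /isomE[f [g [fK gK]]].
pose v : 'rV[R]_n := \row_i ((g (delta_mx i 0)).2 : R).
have vE u : row_form v u = (g u).2.
  have -> : (g u).2 = (\sum_i (u i 0 : R^c) *: (g (delta_mx i 0))).2.
    rewrite {1}(col_sum u) linear_sum; congr (_.2).
    by apply: eq_bigr => i _; rewrite linearZ.
  rewrite (big_morph snd (id1 := 0) (op1 := +%R)) //.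
  by apply: eq_bigr => i _; rewrite !mxE.
exists v; split.
  exists (fun i => f (0, 1) i 0).
  by rewrite -[LHS]/(row_form v (f (0, 1))) vE fK.
have kP x : f (x, 0) \in ker_pred v by apply/eqP; rewrite vE fK.
apply: (@isomI _ _ _ (fun k => (g (ker_val k)).1) (fun x => KerRow (kP x))).
- by move=> a x y; rewrite -[ker_val _]/(a *: ker_val x + ker_val y) linearP.
- move=> x; apply: val_inj; rewrite /= -[RHS]gK; congr (f _).
  by have := ker_rowP x; rewrite vE; case: (g _) => a b /= ->.
- by move=> x /=; rewrite fK.
Qed.

Lemma linear_col_mulmx k (f : {linear 'cV[R^c]_n -> 'cV[R^c]_k}) :
  forall u, f u =
    ((\matrix_(i, j) (f (delta_mx j 0) i 0 : R)) : 'M[R]_(k, n)) *m (u : 'cV[R]_n).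
Proof.
move=> u; rewrite {1}(col_sum u) linear_sum; apply/colP => i.
rewrite summxE mxE; apply: eq_bigr => j _.
by rewrite linearZ !mxE.
Qed.

Lemma col_endo_eq (A B : 'M[R]_n) :
  (forall u : 'cV[R]_n, A *m u = B *m u) -> A = B.
Proof.
move=> h; apply/matrixP => i j.
have := h (delta_mx j 0); move=> /colP/(_ i).
by rewrite -!colE !mxE.
Qed.

Lemma GL_of_linear_bij (f : 'cV[R^c]_n -> 'cV[R^c]_n)
    (g : 'cV[R^c]_n -> 'cV[R^c]_n) :
  linear f -> cancel f g -> cancel g f ->
  exists s : GL R n, forall u : 'cV[R]_n, s *m u = f u.
Proof.
move=> fl fK gK; have [f' f'E] := linear_fun fl.
have [|g' g'E] := @linear_fun _ _ _ g.
  by move=> a x y; apply: (can_inj fK); rewrite fl !gK.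
pose F : 'M[R]_n := \matrix_(i, j) (f' (delta_mx j 0) i 0 : R).
pose G : 'M[R]_n := \matrix_(i, j) (g' (delta_mx j 0) i 0 : R).
have FP : `[< mx_invertible F >].
  apply/asboolP; exists G; split; apply: col_endo_eq => u;
  by rewrite -mulmxA -!linear_col_mulmx f'E g'E ?fK ?gK mul1mx.
by exists (MkGL FP) => u; rewrite /= -linear_col_mulmx f'E.
Qed.

End RowKernel.

Section FirstRow.
Variables (R : pzRingType) (m : nat).

Lemma e1row_Um : Um R m.+1 (e1row R m).
Proof.
exists (fun i => (i == 0)%:R); rewrite (bigD1 0) //= big1 => [|i /negbTE i0].
  by rewrite mxE !eqxx mul1r addr0.
by rewrite i0 mulr0.
Qed.

Lemma row_form_e1row (u : 'cV[R^c]_m.+1) : row_form (e1row R m) u = u 0 0.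
Proof.
rewrite /row_form (bigD1 0) //= big1 => [|i /negbTE i0].
  by rewrite mxE !eqxx mul1r addr0.
by rewrite mxE i0 andbF mul0r.
Qed.

Lemma col_mx_head (T : Type) (a : 'cV[T]_1) (u : 'cV[T]_m) :
  (col_mx a u : 'cV[T]_m.+1) 0 0 = a 0 0.
Proof.
have -> : 0 = lshift m (0 : 'I_1) :> 'I_(1 + m) by apply: val_inj.
exact: col_mxEu.
Qed.

Lemma isom_ker_row_e1row : isom (ker_row (e1row R m)) 'cV[R^c]_m.
Proof.
have P (u : 'cV[R^c]_m) :
    (col_mx (0 : 'cV[R^c]_1) u : 'cV[R^c]_m.+1) \in ker_pred (e1row R m).
  apply/eqP; rewrite row_form_e1row.
  by rewrite col_mx_head mxE.
apply: (@isomI _ _ _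
  (fun k : ker_row _ => dsubmx (ker_val k : 'cV[R^c]_(1 + m)))
  (fun u => KerRow (P u))).
- by move=> a x y; apply/colP => i; rewrite !mxE.
- move=> x; apply: val_inj.
  rewrite /= -[RHS](vsubmxK (ker_val x : 'cV[R^c]_(1 + m))); congr col_mx.
  apply/colP => i; rewrite !mxE ord1.
  have -> : lshift m (0 : 'I_1) = 0 :> 'I_(1 + m) by apply: val_inj.
  by rewrite -row_form_e1row ker_rowP.
- by move=> u; rewrite /= col_mxKd.
Qed.

(** A vector on which v takes the value 1, followed by a basis of the kernel of v,
    is a basis of R^n in which v is the first coordinate; the inverse of the matrix
    of that basis has v as its first row. *)
Lemma completable_of_free_ker (v : 'rV[R]_m.+1) : Um R m.+1 v ->
  isom (ker_row v) 'cV[R^c]_m -> exists s : GL R m.+1, e1row R m *m s = v.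
Proof.
move=> /[dup] Uv [c vc] /isomE[f [g [fK gK]]].
pose w : 'cV[R^c]_m.+1 := \col_i (c i : R^c).
have vw : row_form v w = 1.
  by rewrite -vc; apply: eq_bigr => i _; rewrite mxE.
have P u : u - (row_form v u : R^c) *: w \in ker_pred v.
  by apply/eqP; rewrite row_formD row_formN row_formZ vw mul1r subrr.
have z : lshift m (0 : 'I_1) = 0 :> 'I_(1 + m) by apply: val_inj.
pose F (u : 'cV[R^c]_m.+1) : 'cV[R^c]_m.+1 :=
  col_mx (const_mx (row_form v u : R^c) : 'cV[R^c]_1) (f (KerRow (P u))).
pose G (u : 'cV[R^c]_m.+1) : 'cV[R^c]_m.+1 :=
  ker_val (g (dsubmx (u : 'cV[R^c]_(1 + m)))) + (u 0 0 : R^c) *: w.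
have vG u : row_form v (G u) = u 0 0.
  by rewrite row_formD row_formZ vw mul1r ker_rowP add0r.
have Gl : linear G.
  move=> a x y; rewrite /G linearP linearP.
  rewrite -[ker_val _]/(a *: ker_val _ + ker_val _) !mxE.
  by rewrite scalerDl scalerDr scalerA addrACA.
have GK : cancel G F.
  move=> u; rewrite /F; set a := const_mx _; set b := f _.
  have -> : a = usubmx (u : 'cV[R^c]_(1 + m)).
    by apply/colP => i; rewrite !mxE ord1 z vG.
  have -> : b = dsubmx (u : 'cV[R^c]_(1 + m)); last first.
    exact (vsubmxK (u : 'cV[R^c]_(1 + m))).
  rewrite -[RHS]gK; congr (f _); apply: val_inj.
  by rewrite /= vG /G addrK.
have FK : cancel F G.
  move=> u; rewrite /G /F col_mxKd fK /=.
  by rewrite col_mx_head mxE subrK.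
have [s sE] := GL_of_linear_bij Gl GK FK.
have vs : v *m s = e1row R m.
  apply/rowP => i.
  have := vG (delta_mx i 0); rewrite -sE -row_form_mulmx row_form_delta => ->.
  by rewrite !mxE eq_sym andbT.
by exists s^-1%g; rewrite -vs -mulmxA GLmulmxV mulmx1.
Qed.

End FirstRow.
(** * Generated subgroups *)

Section Subgroups.
Variable G : groupType.
Implicit Types (S H K : set G) (x y : G).

Lemma generated_subgroup S : subgroup (generated S).
Proof.
split=> [H [[H1 _ _] _]//|x y Sx Sy H HS|x Sx H HS].
  by have [[_ HM _] _] := HS; apply: HM; [apply: Sx|apply: Sy].
by have [[_ _ HV] _] := HS; apply: HV; apply: Sx.
Qed.

Lemma sub_generated S x : S x -> generated S x.
Proof. by move=> Sx H [_]; apply. Qed.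

Lemma generated_sub S H : subgroup H -> S `<=` H -> generated S `<=` H.
Proof. by move=> HG SH x; apply; split. Qed.

Lemma subgroup_gcoset H x y : subgroup H ->
  gcoset x H = gcoset y H <-> H (x^-1 * y)%g.
Proof.
move=> [H1 HM HV]; split=> [xy|xy].
  have : gcoset y H y by exists 1%g; rewrite ?mulg1.
  by rewrite -xy => -[h Hh <-]; rewrite mulKg.
apply/seteqP; split=> z [h Hh <-].
  exists ((x^-1 * y)^-1 * h)%g; first exact: HM (HV _ xy) Hh.
  by rewrite invgM invgK !mulgA mulgV mul1g.
exists (x^-1 * y * h)%g; first exact: HM.
by rewrite !mulgA mulgV mul1g.
Qed.

Lemma subgroupI H K : subgroup H -> subgroup K -> subgroup (H `&` K).
Proof.
move=> [H1 HM HV] [K1 KM KV]; split=> [//|x y [? ?] [? ?]|x [? ?]].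
  by split; [apply: HM|apply: KM].
by split; [apply: HV|apply: KV].
Qed.

End Subgroups.

Section GroupMorphism.
Variables (G G' : groupType) (f : G -> G').
Hypothesis fM : {morph f : x y / (x * y)%g}.

Lemma morph_group1 : f 1%g = 1%g.
Proof. by apply: (@mulgI _ (f 1%g)); rewrite -fM !mulg1. Qed.

Lemma morph_groupV x : f x^-1%g = (f x)^-1%g.
Proof. by apply/esym/mulg1_eq; rewrite -fM mulgV morph_group1. Qed.

Lemma morph_generated (S : set G) (S' : set G') :
  f @` S = S' -> f @` generated S = generated S'.
Proof.
move=> SS'; have [G1 GM GV] := generated_subgroup S.
have [G'1 G'M G'V] := generated_subgroup S'.
apply/seteqP; split=> [_ [x Sx <-]|].
  suff : generated S `<=` f @^-1` generated S' by apply.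
  apply: generated_sub => [|y Sy].
    split=> [|a b|a] /=; rewrite ?fM ?morph_group1 ?morph_groupV //.
    - exact: G'M.
    - exact: G'V.
  by apply: sub_generated; rewrite -SS'; exists y.
apply: generated_sub => [|y].
  split=> [|_ _ [a ? <-] [b ? <-]|_ [a ? <-]].
  - by exists 1%g; rewrite ?morph_group1.
  - by exists (a * b)%g; rewrite ?fM //; apply: GM.
  - by exists a^-1%g; rewrite ?morph_groupV //; apply: GV.
by rewrite -SS' => -[x Sx <-]; exists x => //; apply: sub_generated.
Qed.

End GroupMorphism.

(** * Local elements of the Steinberg group *)

Section LocalElements.
Variables (R : pzRingType) (n : nat).
Local Notation St := (St R n).
Local Notation theta := (@theta R n).
Implicit Types (x y z : St) (a b : {set 'I_n * 'I_n}) (i j k l : 'I_n).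

Lemma theta1 : theta 1%g = 1%g.
Proof. exact: morph_group1 (@thetaM R n). Qed.

Lemma thetaV x : theta x^-1%g = (theta x)^-1%g.
Proof. exact: morph_groupV (@thetaM R n) x. Qed.

Lemma St_local_subgroup a : subgroup (St_local R a).
Proof. exact: generated_subgroup. Qed.

Lemma St_local1 a : St_local R a 1%g.
Proof. by case: (St_local_subgroup a). Qed.

Lemma St_localM a x y : St_local R a x -> St_local R a y -> St_local R a (x * y)%g.
Proof. by case: (St_local_subgroup a) => _ + _; apply. Qed.

Lemma St_localV a x : St_local R a x -> St_local R a x^-1%g.
Proof. by case: (St_local_subgroup a) => _ _; apply. Qed.

Lemma En_subgroup : subgroup (En R n).
Proof. exact: generated_subgroup. Qed.

Lemma En_local_subgroup a : subgroup (En_local R a).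
Proof. exact: generated_subgroup. Qed.

Lemma theta_St_local a : theta @` St_local R a = En_local R a.
Proof.
apply: morph_generated; first exact: thetaM.
apply/seteqP; split=> [_ [_ [i [j [ij [r [aij ->]]]]] <-]|_ [i [j [ij [r [aij ->]]]]]].
  by exists i, j, ij, r; rewrite thetaX.
by exists (stX ij r); [exists i, j, ij, r|rewrite thetaX].
Qed.

Definition letter (l : st_index R n * bool) : St :=
  if l.2 then (pgen (@st_rel R n) l.1)^-1%g else pgen _ l.1.

Lemma pclassM (u w : word (st_index R n)) :
  (pclass (@st_rel R n) u * pclass _ w)%g = pclass _ (u ++ w).
Proof. exact: pmulE. Qed.

Lemma letterE (l : st_index R n * bool) : letter l = pclass (@st_rel R n) [:: l].
Proof.
case: l => i [] //; rewrite /letter /=; apply: mulg1_eq.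
by rewrite /pgen pclassM; apply/pclassP/word_eq_cancel.
Qed.

Lemma prod_letters (w : word (st_index R n)) :
  (\prod_(l <- w) letter l)%g = pclass (@st_rel R n) w.
Proof.
elim: w => [|l w IH]; first by rewrite big_nil.
by rewrite big_cons IH letterE pclassM.
Qed.

Lemma stX_letter i j (ij : i != j) (r : R) (b : bool) :
  letter (st_letter ij r b) = (if b then (stX ij r)^-1 else stX ij r)%g.
Proof. by []. Qed.

Lemma st_index_stX (i : st_index R n) : pgen (@st_rel R n) i = stX (valP i.1) i.2.
Proof.
case: i => [[[i j] ij] r]; rewrite /stX; congr (pgen _ (_, _)).
exact: val_inj.
Qed.

Lemma theta_En : range theta = En R n.
Proof.
have -> : [set: St] = generated [set y | exists i j (ij : i != j) r, y = stX ij r].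
  apply/seteqP; split=> // x _; rewrite -[x]pclassK -prod_letters.
  have [G1 GM GV] := generated_subgroup
    [set y : St | exists i j (ij : i != j) (r : R), y = stX ij r].
  elim/big_ind: _ => // -[i b] _.
  have Gi : generated [set y | exists i j (ij : i != j) (r : R), y = stX ij r]
      (pgen (@st_rel R n) i).
    by apply: sub_generated; rewrite st_index_stX; exists _, _, (valP i.1), i.2.
  by rewrite /letter; case: b => //=; apply: GV.
apply: morph_generated; first exact: thetaM.
apply/seteqP; split=> [_ [_ [i [j [ij [r ->]]]] <-]|_ [i [j [ij [r ->]]]]].
  by exists i, j, ij, r; rewrite thetaX.
by exists (stX ij r); [exists i, j, ij, r|rewrite thetaX].
Qed.

Definition local x : Prop := exists a, nilpotent_set a /\ St_local R a x.

Lemma nilpotent_set0 : nilpotent_set (finset.set0 : {set 'I_n * 'I_n}).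
Proof. by split=> [|i j|i j k]; rewrite ?finset.sub0set ?finset.in_set0. Qed.

Lemma local1 : local 1%g.
Proof. exists finset.set0; split; [exact: nilpotent_set0|exact: St_local1]. Qed.

Lemma nilpotent_set1 i j : i != j -> nilpotent_set [set (i, j)]%SET.
Proof.
move=> ij; split=> [|k l|k l h].
- by rewrite finset.sub1set finset.inE.
- rewrite !finset.inE => /eqP[-> ->]; apply/eqP => -[e _].
  by rewrite e eqxx in ij.
- rewrite !finset.inE => /eqP[_ ->] /eqP[e _].
  by rewrite e eqxx in ij.
Qed.

Lemma nilpotent_set2 i j k l : i != j -> k != l -> j != k -> i != l ->
  nilpotent_set [set (i, j); (k, l)]%SET.
Proof.
move=> ij kl jk il; split=> [|p q|p q r].
- by apply/fintype.subsetP => t /finset.set2P[] ->; rewrite finset.inE.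
- rewrite !finset.inE => /orP[] /eqP[-> ->]; apply/negP;
  move=> /orP[] /eqP[] *; subst; by move: ij kl jk il; rewrite ?eqxx.
- rewrite !finset.inE => /orP[] /eqP[-> ->];
  move=> /orP[] /eqP[] *; subst; by move: ij kl jk il; rewrite ?eqxx ?orbT.
Qed.

Lemma nilpotent_set3 i j l : i != j -> j != l -> i != l ->
  nilpotent_set [set (i, j); (j, l); (i, l)]%SET.
Proof.
move=> ij jl il; split=> [|p q|p q r].
- by apply/fintype.subsetP => t; rewrite !finset.inE => /orP[/orP[]|] /eqP ->.
- rewrite !finset.inE => /orP[/orP[]|] /eqP[-> ->]; apply/negP;
  move=> /orP[/orP[]|] /eqP[] *; subst;
  by move: ij jl il; rewrite ?eqxx.
- rewrite !finset.inE => /orP[/orP[]|] /eqP[-> ->];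
  move=> /orP[/orP[]|] /eqP[] *; subst;
  by move: ij jl il; rewrite ?eqxx ?orbT.
Qed.

Lemma St_local_stX a i j (ij : i != j) (r : R) : (i, j) \in a ->
  St_local R a (stX ij r).
Proof. by move=> aij; apply: sub_generated; exists i, j, ij, r. Qed.

Lemma local_letter (l : st_index R n * bool) : local (letter l).
Proof.
exists [set (val l.1.1)]%SET; split.
  by case: (l.1.1) => -[i j] ij; apply: nilpotent_set1.
have h : St_local R [set (val l.1.1)]%SET (pgen (@st_rel R n) l.1).
  by rewrite st_index_stX; apply: St_local_stX; rewrite finset.inE -surjective_pairing.
by rewrite /letter; case: l.2 => //; apply: St_localV.
Qed.

(** The sets needed are {(i,j)}, {(i,j), (k,l)} and {(i,j), (j,l), (i,l)}; the
    side conditions j != k and i != l of the commutation relation are what makes the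
    second one nilpotent. *)
Lemma st_rel_local (w w' : word (st_index R n)) : st_rel w w' ->
  exists a, nilpotent_set a /\
    forall l : st_index R n * bool, l \in w ++ w' -> St_local R a (letter l).
Proof.
have L a i j (ij : i != j) r (b : bool) :
    (i, j) \in a -> St_local R a (letter (st_letter ij r b)).
  move=> aij; rewrite stX_letter; case: b; last exact: St_local_stX.
  by apply: St_localV; apply: St_local_stX.
case=> [i j ij r s|i j k l ij kl r s jk il|i j l ij jl il r s].
- exists [set (i, j)]%SET; split=> [|t]; first exact: nilpotent_set1.
  by rewrite !inE => /or3P[] /eqP->; apply: L; rewrite finset.inE.
- exists [set (i, j); (k, l)]%SET; split=> [|t]; first exact: nilpotent_set2.
  by rewrite !inE => /or4P[] /eqP->; apply: L; rewrite !finset.inE eqxx ?orbT.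
exists [set (i, j); (j, l); (i, l)]%SET; split=> [|t]; first exact: nilpotent_set3.
rewrite !inE orbA => /orP[|/or3P[]]; last 3 first.
- by move=> /eqP->; apply: L; rewrite !finset.inE eqxx ?orbT.
- by move=> /eqP->; apply: L; rewrite !finset.inE eqxx ?orbT.
- by move=> /eqP->; apply: L; rewrite !finset.inE eqxx ?orbT.
by move=> /orP[] /eqP->; apply: L; rewrite !finset.inE eqxx ?orbT.
Qed.

End LocalElements.
(** * Paths and homotopies of rows *)

Section Frames.
Variables (R : pzRingType) (n : nat).
Local Notation St := (St R n).
Local Notation row := 'rV[R]_n.
Local Notation theta := (@theta R n).
Implicit Types (x y z t : row) (g h : St) (a : {set 'I_n * 'I_n}).

Definition near a x y : Prop := exists g, St_local R a g /\ y = x *m theta g.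

Lemma mulmx_thetaM x g h : x *m theta (g * h)%g = x *m theta g *m theta h.
Proof. by rewrite thetaM mulmxA. Qed.

Lemma mulmx_theta1 x : x *m theta 1%g = x.
Proof. by rewrite theta1 mulmx1. Qed.

Lemma mulmx_thetaK x g : x *m theta g *m theta g^-1%g = x.
Proof. by rewrite -mulmx_thetaM mulgV mulmx_theta1. Qed.

Lemma near_refl a x : near a x x.
Proof. exists 1%g; split; [exact: St_local1|by rewrite mulmx_theta1]. Qed.

Lemma near_sym a x y : near a x y -> near a y x.
Proof.
move=> [g [ag ->]]; exists g^-1%g; split; first exact: St_localV.
by rewrite mulmx_thetaK.
Qed.

Lemma near_trans a x y z : near a x y -> near a y z -> near a x z.
Proof.
move=> [g [ag ->]] [h [ah ->]]; exists (g * h)%g; split; first exact: St_localM.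
by rewrite mulmx_thetaM.
Qed.

Variable U : set row.
Hypothesis Uact : forall x g, U x -> U (x *m theta g).

Lemma near_U a x y : near a x y -> U x -> U y.
Proof. by move=> [g [_ ->]]; apply: Uact. Qed.

(** Since theta maps local subgroups onto local groups, frames can be described
    in the Steinberg group, and any of their points may serve as origin. *)
Lemma local_frameP (F : set row) x : finite_set F -> F x ->
  local_frame U F <->
  U x /\ exists a, nilpotent_set a /\ forall y, F y -> near a x y.
Proof.
move=> finF Fx; split=> [[_ _ FU [v [a [_ na Fv]]]]|[Ux [a [na Fn]]]].
  have vn y : F y -> near a v y.
    by move=> /Fv [h]; rewrite -theta_St_local => -[g ag <-] <-; exists g.
  split; [exact: FU|exists a; split=> // y Fy].
  exact: near_trans (near_sym (vn _ Fx)) (vn _ Fy).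
split=> //; first by exists x.
  by move=> y /Fn h; apply: near_U h Ux.
exists x, a; split=> // y /Fn[g [ag ->]]; exists (theta g) => //.
by rewrite -theta_St_local; exists g.
Qed.

Lemma edgeP x y : local_frame U [set x; y] <->
  U x /\ exists a, nilpotent_set a /\ near a x y.
Proof.
rewrite (@local_frameP [set x; y] x) //=; last by left.
split=> -[Ux [a [na h]]]; split=> //; exists a; split=> //.
  by apply: h; right.
by move=> z [->|->] //; apply: near_refl.
Qed.

(** The corners of a unit square, as two opposite sides x y and z t. *)
Definition square x y z t : Prop :=
  U x /\ exists a, [/\ nilpotent_set a, near a x y, near a x z & near a x t].

Lemma squareP (H : int -> int -> row) (j k : int) :
  local_frame U [set H p.1 p.2 | p in [set j; j + 1] `*` [set k; k + 1]] <->
  square (H j k) (H (j + 1) k) (H j (k + 1)) (H (j + 1) (k + 1)).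
Proof.
rewrite (@local_frameP _ (H j k)); last first.
- by exists (j, k) => //; split; left.
- by apply: finite_image; apply: finite_setX.
split=> -[Ux [a]] h; split=> //; exists a.
  case: h => na h; split=> //; apply: h.
  - by exists (j + 1, k) => //; split; [right|left].
  - by exists (j, k + 1) => //; split; [left|right].
  - by exists (j + 1, k + 1) => //; split; right.
case: h => na h1 h2 h3; split=> // _ [[p q] [/= pj qk] <-].
by case: pj => ->; case: qk => -> //; apply: near_refl.
Qed.

Lemma square_edge x y : local_frame U [set x; y] -> square x y x y.
Proof.
by move=> /edgeP[Ux [a [na h]]]; split=> //; exists a; split=> //; apply: near_refl.
Qed.

Lemma square_near x y z t a : U x -> nilpotent_set a ->
  near a x y -> near a x z -> near a x t -> square x y z t.
Proof. by move=> Ux na h1 h2 h3; split=> //; exists a. Qed.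

Lemma square_swap x y z t : square x y z t -> square z t x y.
Proof.
move=> [Ux [a [na h1 h2 h3]]]; split; first exact: near_U h2 Ux.
by exists a; have h := near_sym h2; split=> //; apply: near_trans h _.
Qed.

(** ** Homotopies *)

Lemma path_edge v v' w (k : int) : ga_path U v v' w -> local_frame U [set w k; w (k + 1)].
Proof. by case. Qed.

Lemma path_unique v v' u u' w : ga_path U v v' w -> ga_path U u u' w ->
  v = u /\ v' = u'.
Proof.
move=> [_ [k0 h0] [k1 h1]] [_ [j0 g0] [j1 g1]]; split.
  rewrite -(h0 (Num.min k0 j0)); last by lia.
  by rewrite g0 //; lia.
rewrite -(h1 (Num.max k1 j1)); last by lia.
by rewrite g1 //; lia.
Qed.

Lemma homotopic_sym w w' : stably_homotopic U w w' -> stably_homotopic U w' w.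
Proof.
move=> [H [Hs [x [y Hp]] [k0 h0] [k1 h1]]].
exists (fun j k => H j (- k)); split.
- move=> j k; apply/(squareP (fun j k => H j (- k))); apply: square_swap.
  have /squareP := Hs j (- (k + 1)).
  by have -> : - (k + 1) + 1 = - k by lia.
- by exists x, y => k.
- by exists (- k1) => k kk; apply: h1; lia.
- by exists (- k0) => k kk; apply: h0; lia.
Qed.

(** The second homotopy is translated in the second variable so as to start where
    the first one has become constant. *)
Lemma homotopic_trans w w' w'' : stably_homotopic U w w' ->
  stably_homotopic U w' w'' -> stably_homotopic U w w''.
Proof.
move=> [H [Hs [x [y Hp]] [k0 h0] [k1 h1]]] [H' [Hs' [x' [y' Hp']] [k0' h0'] [k1' h1']]].
have [ex ey] : x = x' /\ y = y'.
  apply: (path_unique (w := w')); first by rewrite -(h1 k1).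
  by rewrite -(h0' k0').
pose K (j k : int) := if (k <= k1)%R then H j k else H' j (k - k1 + k0').
have K1 k j : k <= k1 -> K j k = H j k by rewrite /K => ->.
have K2 k j : k1 <= k -> K j k = H' j (k - k1 + k0').
  rewrite /K => kk; case: ifP => // kk'.
  have -> : k = k1 by lia.
  have -> : k1 - k1 + k0' = k0' by lia.
  by rewrite -[H j k1]/((H ^~ k1) j) h1 // -[H' j k0']/((H' ^~ k0') j) h0'.
have E k : K ^~ k = (if k <= k1 then H ^~ k else H' ^~ (k - k1 + k0')).
  by apply/funext => j; rewrite /K; case: ifP.
exists K; split.
- move=> j k; apply/squareP; have [kk|kk] := ltP k k1.
    by rewrite !K1 ?(ltW kk) //; [apply/squareP|lia|lia].
  rewrite !K2; try lia.
  have -> : k + 1 - k1 + k0' = k - k1 + k0' + 1 by lia.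
  exact/squareP.
- exists x, y => k; rewrite E; case: ifP => _; first exact: Hp.
  by rewrite ex ey; apply: Hp'.
- exists (Num.min k0 k1) => k kk; rewrite E; case: ifP => kk'; first by apply: h0; lia.
  by lia.
- exists (Num.max (k1 + 1) (k1 - k0' + k1')) => k kk; rewrite E; case: ifP => kk'.
    by lia.
  by apply: h1'; lia.
Qed.

(** A homotopy with a single nontrivial step, between the rows 0 and 1. *)
Lemma homotopic_squares v v' w w' : ga_path U v v' w -> ga_path U v v' w' ->
  (forall j : int, square (w j) (w (j + 1)) (w' j) (w' (j + 1))) ->
  stably_homotopic U w w'.
Proof.
move=> pw pw' sq; pose H (j k : int) := if k <= 0 then w j else w' j.
have E k : H ^~ k = if k <= 0 then w else w'.
  by apply/funext => j; rewrite /H; case: ifP.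
exists H; split.
- move=> j k; apply/squareP; rewrite /H.
  have [k0|k0] := leP k 0; have [k1|k1] := leP (k + 1) 0.
  + exact: square_edge (path_edge _ pw).
  + exact: sq.
  + by lia.
  + exact: square_edge (path_edge _ pw').
- by exists v, v' => k; rewrite E; case: ifP.
- by exists 0 => k k0; rewrite E k0.
- by exists 1 => k k0; rewrite E; case: ifP => //; lia.
Qed.

Lemma homotopic_refl v v' w : ga_path U v v' w -> stably_homotopic U w w.
Proof.
move=> pw; apply: homotopic_squares (pw) (pw) _ => j.
exact: square_edge (path_edge _ pw).
Qed.

Definition stutter (k : int) (w : int -> row) : int -> row :=
  fun j => if j <= k then w j else w (j - 1).

Lemma stutter_path k v v' w : ga_path U v v' w -> ga_path U v v' (stutter k w).
Proof.
move=> pw; have [_ [k0 h0] [k1 h1]] := pw; split.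
- move=> j; rewrite /stutter; have [jk|jk] := leP j k; have [jk'|jk'] := leP (j + 1) k.
  + exact: path_edge pw.
  + have -> : j + 1 - 1 = j by lia.
    have /edgeP[Uj _] := path_edge j pw; apply/edgeP; split=> //.
    by exists finset.set0; split; [exact: nilpotent_set0|exact: near_refl].
  + by lia.
  + have -> : j + 1 - 1 = j - 1 + 1 by lia.
    exact: path_edge pw.
- exists k0 => j jk; rewrite /stutter; case: ifP => _; apply: h0; lia.
- exists (k1 + 1) => j jk; rewrite /stutter; case: ifP => _; apply: h1; lia.
Qed.

(** The repeated point is moved to the right, one place at each step, until it is
    absorbed in the part where the path is constant. Every square on the way has
    its corners on a single edge of w. *)
Lemma stutter_homotopic k v v' w : ga_path U v v' w ->
  stably_homotopic U (stutter k w) w.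
Proof.
move=> pw; have [_ [k0 h0] [k1 h1]] := pw.
pose H (j i : int) := stutter (k + Num.max i 0) w j.
exists H; split.
- move=> j i; apply/squareP; rewrite /H.
  have [i0|i0] := ltP i 0.
    have -> : Num.max (i + 1) 0 = 0 by lia.
    exact: square_edge (path_edge _ (stutter_path _ pw)).
  have -> : k + Num.max (i + 1) 0 = k + i + 1 by lia.
  (* The rows of this square repeat the points i and i + 1. *)
  move: (k + i) => {i i0} i.
  have jj : j - 1 + 1 = j by lia.
  have jj' : j + 1 - 1 = j by lia.
  have /edgeP[Uj [a [na ha]]] := path_edge j pw.
  have := path_edge (j - 1) pw; rewrite jj => /edgeP[Uj' [b [nb hb]]].
  rewrite /stutter jj'.
  have [ji|ji] : j < i \/ i <= j by lia.
    have -> : j <= i by lia.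
    have -> : j + 1 <= i by lia.
    have -> : j <= i + 1 by lia.
    have -> : j + 1 <= i + 1 by lia.
    by apply: square_near na _ _ _ => //; apply: near_refl.
  have [ji'|ji'] : i + 1 < j \/ j <= i + 1 by lia.
    have -> : (j <= i) = false by lia.
    have -> : (j + 1 <= i) = false by lia.
    have -> : (j <= i + 1) = false by lia.
    have -> : (j + 1 <= i + 1) = false by lia.
    by apply: square_near nb _ _ _ => //; apply: near_refl.
  have [ji''|ji''] : j <= i \/ i < j by lia.
    have -> : j <= i by lia.
    have -> : (j + 1 <= i) = false by lia.
    have -> : j <= i + 1 by lia.
    have -> : (j + 1 <= i + 1) by lia.
    by apply: square_near na _ _ _ => //; apply: near_refl.
  have -> : (j <= i) = false by lia.
  have -> : (j + 1 <= i) = false by lia.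
  have -> : (j <= i + 1) by lia.
  have -> : (j + 1 <= i + 1) = false by lia.
  by apply: square_near nb _ _ _ => //; apply: near_refl.
- by exists v, v' => i; apply: stutter_path.
- by exists 0 => i i0; apply/funext => j; rewrite /H; congr stutter; lia.
- exists (Num.max 0 (k1 - k)) => i i0; apply/funext => j; rewrite /H /stutter.
  by case: ifP => // ji; rewrite !h1 //; lia.
Qed.

Definition skip (k : int) (w : int -> row) : int -> row :=
  fun j => if j < k then w j else w (j + 1).

(** The skipped path and w do not run synchronously: skipping k and then
    stuttering there only replaces w k by w (k + 1), which is a single
    step, and the stutter can be removed. *)
Lemma skip_homotopic k v v' w a : ga_path U v v' w ->
  nilpotent_set a -> near a (w (k - 1)) (w k) -> near a (w k) (w (k + 1)) ->
  stably_homotopic U w (skip k w).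
Proof.
move=> pw na h1 h2; have [_ [k0 g0] [k1 g1]] := pw.
have Uw j : U (w j) by have /edgeP[] := path_edge j pw.
have ps : ga_path U v v' (skip k w).
  split.
  - move=> j; rewrite /skip; have [jk|jk] := ltP j k; have [jk'|jk'] := ltP (j + 1) k.
    + exact: path_edge pw.
    + apply/edgeP; split=> //; exists a; split=> //.
      have -> : j = k - 1 by lia.
      have -> : k - 1 + 1 = k by lia.
      exact: near_trans h1 h2.
    + by lia.
    + exact: path_edge pw.
  - by exists (k0 - 1) => j jk; rewrite /skip; case: ifP => _; apply: g0; lia.
  - by exists k1 => j jk; rewrite /skip; case: ifP => _; apply: g1; lia.
apply: homotopic_trans (stutter_homotopic k ps).
apply: homotopic_squares (pw) (stutter_path k ps) _ => j.
have E i : i != k -> stutter k (skip k w) i = w i.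
  move=> ik; rewrite /stutter /skip; case: ifP => ik1.
    by case: ifP => //; lia.
  by case: ifP; [lia|have -> : i - 1 + 1 = i by lia].
have Ek : stutter k (skip k w) k = w (k + 1).
  by rewrite /stutter /skip lexx ltxx.
have [->|jk] := eqVneq j k.
  rewrite Ek E; last by lia.
  by apply: square_near na _ _ _.
have [jk'|jk'] := eqVneq (j + 1) k.
  rewrite jk' Ek E //.
  have -> : j = k - 1 by lia.
  apply: square_near na _ _ _ => //; first exact: near_refl.
  exact: near_trans h1 h2.
rewrite !E //; exact: (square_edge (path_edge _ pw)).
Qed.

(** A stutter placed before the path starts to move delays it by one. *)
Lemma delay_homotopic v v' w (d : nat) : ga_path U v v' w ->
  stably_homotopic U w (fun k => w (k - d%:Z)).
Proof.
move=> pw; have [_ [k0 h0] _] := pw.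
elim: d => [|d IH].
  have -> : (fun k : int => w (k - 0%N%:Z)) = w by apply/funext => k; congr w; lia.
  exact: homotopic_refl pw.
apply: homotopic_trans IH _; apply: homotopic_sym.
have pd : ga_path U v v' (fun k => w (k - d%:Z)).
  have [h [j0 h0'] [j1 h1]] := pw; split.
  - move=> k; have -> : k + 1 - d%:Z = k - d%:Z + 1 by lia.
    exact: h.
  - by exists j0 => k kj; apply: h0'; lia.
  - by exists (j1 + d%:Z) => k kj; apply: h1; lia.
have -> : (fun k : int => w (k - d.+1%:Z)) = stutter k0 (fun k => w (k - d%:Z)).
  apply/funext => k; rewrite /stutter; case: ifP => kk.
    by rewrite !h0 //; lia.
  by congr w; lia.
exact: stutter_homotopic pd.
Qed.

(** ** Paths attached to products of local elements *)

Section Walk.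
Variable v : row.
Hypothesis Uv : U v.
Implicit Types xs ys us vs : seq St.

Definition walk xs (k : int) : row :=
  if k is Posz i then v *m theta (\prod_(x <- take i xs) x)%g else v.

Definition locals xs : Prop := forall g, g \in xs -> local g.

Lemma locals_cat xs ys : locals (xs ++ ys) <-> locals xs /\ locals ys.
Proof.
split=> [h|[hx hy] g]; last by rewrite mem_cat => /orP[/hx|/hy].
by split=> g gx; apply: h; rewrite mem_cat gx ?orbT.
Qed.

Lemma walk_path xs : locals xs ->
  ga_path U v (v *m theta (\prod_(x <- xs) x)%g) (walk xs).
Proof.
move=> lx; split.
- case=> [i|[|i]]; apply/edgeP.
  + have -> : Posz i + 1 = Posz i.+1 by lia.
    split; first exact: Uact.
    have [ix|ix] := ltnP i (size xs).
      have [a [na ha]] := lx _ (mem_nth 1%g ix).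
      exists a; split=> //; exists (nth 1%g xs i); split=> //.
      by rewrite /= (take_nth 1%g ix) -cats1 big_cat big_seq1 mulmx_thetaM.
    exists finset.set0; split; first exact: nilpotent_set0.
    by rewrite /= !take_oversize ?(leqW ix) //; apply: near_refl.
  + split=> //; exists finset.set0; split; first exact: nilpotent_set0.
    by rewrite /= take0 big_nil mulmx_theta1; apply: near_refl.
  + have -> : Negz i.+1 + 1 = Negz i by lia.
    split=> //; exists finset.set0; split; first exact: nilpotent_set0.
    exact: near_refl.
- by exists (Negz 0); case=> [[|i]|].
- exists (size xs)%:Z; case=> i ix; last by lia.
  by rewrite /= take_oversize //; lia.
Qed.

Lemma walk_insert1 us vs :
  walk (us ++ 1%g :: vs) = stutter (size us) (walk (us ++ vs)).
Proof.
apply/funext => -[i|i] /=; last by [].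
rewrite /stutter; have [iu|iu] := leP (Posz i) (size us).
  by rewrite /= !takel_cat //; lia.
have -> : Posz i - 1 = Posz i.-1 by lia.
rewrite /= !take_cat.
have -> : (i < size us)%N = false by lia.
have [iu'|iu'] := ltnP i.-1 (size us); first by lia.
have -> : (i - size us = (i.-1 - size us).+1)%N by lia.
by rewrite /= !big_cat /= big_cons mul1g.
Qed.

Lemma walk_merge us (x y : St) vs :
  walk (us ++ (x * y)%g :: vs) = skip (size us).+1 (walk (us ++ x :: y :: vs)).
Proof.
apply/funext => -[i|i] /=; last by case: i.
rewrite /skip; have [iu|iu] := ltP (Posz i) (size us).+1.
  by rewrite /= !takel_cat //; lia.
have -> : Posz i + 1 = Posz i.+1 by lia.
rewrite /= !take_cat.
have -> : (i < size us)%N = false by lia.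
have -> : (i.+1 < size us)%N = false by lia.
have -> : (i.+1 - size us = (i.-1 - size us).+2)%N by lia.
have -> : (i - size us = (i.-1 - size us).+1)%N by lia.
by rewrite /= !big_cat /= !big_cons !mulgA.
Qed.

(** Quantifying over the surrounding lists makes this a congruence for
    concatenation, like the equivalence of words in a presentation with which it is
    to be compared. *)
Definition move xs ys : Prop :=
  [/\ locals xs, locals ys, (\prod_(x <- xs) x = \prod_(x <- ys) x)%g &
  forall us vs, locals us -> locals vs ->
    stably_homotopic U (walk (us ++ xs ++ vs)) (walk (us ++ ys ++ vs))].

Lemma move_refl xs : locals xs -> move xs xs.
Proof.
move=> lx; split=> // us vs lu lv; apply: homotopic_refl; apply: walk_path.
by apply/locals_cat; split=> //; apply/locals_cat.
Qed.

Lemma move_sym xs ys : move xs ys -> move ys xs.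
Proof. by move=> [lx ly e h]; split=> // us vs lu lv; apply/homotopic_sym/h. Qed.

Lemma move_trans ys xs zs : move xs ys -> move ys zs -> move xs zs.
Proof.
move=> [lx ly e h] [_ lz e' h']; split=> // [|us vs lu lv]; first by rewrite e.
exact: homotopic_trans (h _ _ lu lv) (h' _ _ lu lv).
Qed.

Lemma move_cat xs xs' ys ys' : move xs xs' -> move ys ys' ->
  move (xs ++ ys) (xs' ++ ys').
Proof.
move=> [lx lx' e h] [ly ly' e' h']; split; try by apply/locals_cat.
  by rewrite !big_cat e e'.
move=> us vs lu lv; rewrite -!catA.
apply: homotopic_trans (h _ _ lu _) _; first exact/locals_cat.
by rewrite !(catA us); apply: h' => //; apply/locals_cat.
Qed.

Lemma locals1 (x : St) : local x -> locals [:: x].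
Proof. by move=> lx g; rewrite inE => /eqP ->. Qed.

(** Multiplying by 1 is a stutter. *)
Lemma move_1 : move [:: 1%g] [::].
Proof.
split=> //; [exact/locals1/local1|by rewrite big_seq1 big_nil|].
move=> us vs lu lv; rewrite /= walk_insert1.
by apply: stutter_homotopic (walk_path _); apply/locals_cat.
Qed.

(** The three points involved lie in one orbit of a local group, so the middle one
    can be skipped. *)
Lemma move_merge a (x y : St) : nilpotent_set a -> St_local R a x -> St_local R a y ->
  move [:: x; y] [:: (x * y)%g].
Proof.
move=> na ax ay.
have lxy : locals [:: x; y].
  by move=> g; rewrite !inE => /orP[] /eqP ->; exists a.
split=> //.
- by apply: locals1; exists a; split=> //; apply: St_localM.
- by rewrite big_seq1 big_cons big_seq1.
move=> us vs lu lv /=; rewrite walk_merge.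
have lw : locals (us ++ [:: x; y] ++ vs).
  by apply/locals_cat; split=> //; apply/locals_cat.
have S1 : (size us).+1%:Z - 1 = size us by lia.
have S2 : (size us).+1%:Z + 1 = (size us).+2 by lia.
apply: skip_homotopic (walk_path lw) na _ _; rewrite ?S1 ?S2 /= !take_cat ?ltnn.
  have -> : ((size us).+1 < size us)%N = false by lia.
  have -> : ((size us).+1 - size us = 1)%N by lia.
  rewrite subnn /= ?take0 cats0 big_cat big_seq1 /=; exists x; split=> //.
  by rewrite mulmx_thetaM.
have -> : ((size us).+1 < size us)%N = false by lia.
have -> : ((size us).+2 < size us)%N = false by lia.
have -> : ((size us).+1 - size us = 1)%N by lia.
have -> : ((size us).+2 - size us = 2)%N by lia.
rewrite /= ?take0 !big_cat /= !big_cons !big_nil !mulg1 /=; exists y; split=> //.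
by rewrite mulgA mulmx_thetaM.
Qed.

(** Merging repeatedly collapses a list drawn from one local subgroup. *)
Lemma move_local a xs : nilpotent_set a -> (forall g, g \in xs -> St_local R a g) ->
  move xs [:: (\prod_(x <- xs) x)%g] /\ St_local R a (\prod_(x <- xs) x)%g.
Proof.
move=> na; elim: xs => [_|x xs IH h].
  by rewrite big_nil; split; [exact/move_sym/move_1|exact: St_local1].
have [|m ap] := IH; first by move=> g gx; apply: h; rewrite inE gx orbT.
have ax : St_local R a x by apply: h; rewrite inE eqxx.
rewrite big_cons; split; last exact: St_localM.
apply: move_trans (move_merge na ax ap).
rewrite -cat1s -[[:: x; _]]cat1s; apply: move_cat => //.
by apply/move_refl/locals1; exists a.
Qed.

Lemma move_local2 a xs ys : nilpotent_set a ->
  (forall g, g \in xs ++ ys -> St_local R a g) ->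
  (\prod_(x <- xs) x = \prod_(x <- ys) x)%g -> move xs ys.
Proof.
move=> na h e.
have [|mx _] := @move_local a xs na.
  by move=> g gx; apply: h; rewrite mem_cat gx.
have [|my _] := @move_local a ys na.
  by move=> g gx; apply: h; rewrite mem_cat gx orbT.
by apply: move_trans mx _; rewrite e; apply: move_sym.
Qed.

Definition letters (w : word (st_index R n)) : seq St := map (@letter R n) w.

Lemma letters_cat w w' : letters (w ++ w') = letters w ++ letters w'.
Proof. exact: map_cat. Qed.

Lemma prod_map_letters w : (\prod_(x <- letters w) x)%g = pclass (@st_rel R n) w.
Proof. by rewrite big_map prod_letters. Qed.

Lemma locals_letters w : locals (letters w).
Proof. by move=> _ /mapP[l _ ->]; apply: local_letter. Qed.

(** Both cancellation and the defining relations take place inside one local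
    subgroup, where lists with equal products have equal collapses. *)
Lemma move_word_eq w w' : word_eq (@st_rel R n) w w' -> move (letters w) (letters w').
Proof.
elim=> {w w'} [w|w w' _|w w' w'' _ h _|u u' w w' _ h _ h'|i b|w w' r].
- exact/move_refl/locals_letters.
- exact: move_sym.
- exact: move_trans.
- by rewrite !letters_cat; apply: move_cat.
- have [a [na ha]] := local_letter (i, b).
  apply: (@move_local2 a) => //.
    move=> g; rewrite cats0 !inE => /orP[] /eqP -> //.
    suff -> : letter (i, ~~ b) = (letter (i, b))^-1%g by apply: St_localV.
    by rewrite /letter /=; case: b {ha} => //=; rewrite invgK.
  by rewrite !prod_map_letters; apply/pclassP/word_eq_cancel.
have [a [na ha]] := st_rel_local r.
apply: (@move_local2 a) => //.
  by rewrite -letters_cat => _ /mapP[l lw ->]; apply: ha.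
by rewrite !prod_map_letters; apply/pclassP/word_eq_rel.
Qed.

(** The elements equivalent to a word form a subgroup of the local subgroup, and
    it contains the generators. *)
Lemma move_letters1 a (x : St) : nilpotent_set a -> St_local R a x ->
  exists w, move [:: x] (letters w).
Proof.
move=> na ax.
suff : St_local R a `<=`
    [set x : St | St_local R a x /\ exists w, move [:: x] (letters w)].
  by move=> /(_ _ ax)[].
have mV (y : St) w : St_local R a y -> move [:: y] (letters w) ->
    move [:: y^-1%g] (letters (word_inv w)).
  move=> ay h.
  have lV : locals [:: y^-1%g] by apply: locals1; exists a; split=> //; apply: St_localV.
  (* y^-1 is moved to y^-1 w w^-1, then to y^-1 y w^-1, then to w^-1. *)
  apply: (@move_trans ([:: y^-1%g] ++ letters (w ++ word_inv w))).
    rewrite -{1}[[:: y^-1%g]]cats0; apply: move_cat; first exact: move_refl.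
    by apply: (@move_word_eq [::]); apply/word_eq_sym/word_mulV.
  apply: (@move_trans ([:: y^-1%g] ++ ([:: y] ++ letters (word_inv w)))).
    rewrite letters_cat; apply: move_cat; first exact: move_refl.
    by apply: move_cat; [exact: move_sym|apply/move_refl/locals_letters].
  rewrite catA -[X in move _ X]cat0s.
  apply: move_cat; last exact/move_refl/locals_letters.
  apply: (@move_local2 a) => //.
    move=> g; rewrite cats0 !inE => /orP[] /eqP -> //; exact: St_localV.
  by rewrite big_nil big_cons big_seq1 mulVg.
apply: generated_sub => [|_ [i [j [ij [r [aij ->]]]]]].
  split=> [|y z [ay [w hw]] [az [w' hw']]|y [ay [w hw]]].
  - by split; [exact: St_local1|exists [::]; apply: move_1].
  - split; first exact: St_localM.
    exists (w ++ w'); rewrite letters_cat.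
    apply: move_trans (move_sym (move_merge na ay az)) _.
    by rewrite -[[:: y; z]]cat1s; apply: move_cat.
  - by split; [exact: St_localV|exists (word_inv w); apply: mV].
split; first exact: St_local_stX.
exists [:: st_letter ij r false].
exact: (move_refl (@locals_letters [:: st_letter ij r false])).
Qed.

Lemma move_letters xs : locals xs -> exists w, move xs (letters w).
Proof.
elim: xs => [_|x xs IH lx]; first by exists [::]; apply: move_refl.
have [|w' mw'] := IH; first by move=> g gx; apply: lx; rewrite inE gx orbT.
have [|a [na ax]] := lx x; first by rewrite inE eqxx.
have [w mw] := move_letters1 na ax.
by exists (w ++ w'); rewrite letters_cat -cat1s; apply: move_cat.
Qed.

(** Both lists can be moved to words in the generators; these have the same value
    in the Steinberg group, so they are moved to each other by its relations. *)
Lemma move_prod xs ys : locals xs -> locals ys ->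
  (\prod_(x <- xs) x = \prod_(x <- ys) x)%g -> move xs ys.
Proof.
move=> /move_letters[w mx] /move_letters[w' my] e.
have [[_ _ ex _] [_ _ ey _]] := (mx, my).
apply: (move_trans mx); apply: (move_trans _ (move_sym my)).
by apply/move_word_eq/pclassP; rewrite -!prod_map_letters -ex -ey.
Qed.

Lemma locals_of (g : St) : exists xs, locals xs /\ (\prod_(x <- xs) x)%g = g.
Proof.
exists (letters (repr g)); split; first exact: locals_letters.
by rewrite prod_map_letters pclassK.
Qed.

Definition path_lift (w : int -> row) (L : int -> St) g : Prop :=
  [/\ exists k0 : int, forall k : int, k <= k0 -> L k = 1%g,
      forall k : int, w k = v *m theta (L k),
      forall k : int, local ((L k)^-1 * L (k + 1)%R)%g
    & exists k1 : int, forall k : int, k1 <= k -> L k = g].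

Lemma walk_lift xs : locals xs ->
  path_lift (walk xs)
    (fun k => if k is Posz i then \prod_(x <- take i xs) x else 1)%g
    (\prod_(x <- xs) x)%g.
Proof.
move=> lx; split.
- by exists (Negz 0); case=> [[|i]|].
- by case=> [i|i] //; rewrite mulmx_theta1.
- case=> [i|[|i]].
  + have -> : Posz i + 1 = Posz i.+1 by lia.
    have [ix|ix] := ltnP i (size xs).
      rewrite (take_nth 1%g ix) -cats1 big_cat big_seq1 mulKg.
      exact/lx/mem_nth.
    by rewrite !take_oversize ?(leqW ix) // mulVg; apply: local1.
  + by rewrite /= take0 big_nil mulVg; apply: local1.
  + have -> : Negz i.+1 + 1 = Negz i by lia.
    by rewrite mulVg; apply: local1.
- exists (size xs)%:Z; case=> i ix; last by lia.
  by rewrite take_oversize //; lia.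
Qed.

(** The lift is the running product of elements chosen on the edges; they are
    chosen to be 1 on constant edges so that the product becomes stationary. *)
Lemma path_lift_exists v' w : ga_path U v v' w -> exists L g, path_lift w L g.
Proof.
move=> [we [k0 h0] [k1 h1]].
have step (k : int) : exists x : St, [/\ local x, w (k + 1) = w k *m theta x &
    (w (k + 1) = w k -> x = 1%g)].
  have [e|ne] := pselect (w (k + 1) = w k).
    by exists 1%g; split=> //; [exact: local1|rewrite mulmx_theta1].
  have /edgeP[_ [a [na [g [ag e]]]]] := we k.
  by exists g; split=> //; exists a.
have [f fP] := choice step.
pose L (k : int) : St :=
  (if k - k0 is Posz i then \prod_(j < i) f (k0 + j%:Z)%R else 1)%g.
have L0 (k : int) : k <= k0 -> L k = 1%g.
  move=> kk; rewrite /L; case e: (k - k0) => [[|i]|] //.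
    by rewrite big_ord0.
  by lia.
have LS (k : int) : k0 <= k -> L (k + 1) = (L k * f k)%g.
  move=> kk; rewrite /L.
  have [i ->] : exists i : nat, k = k0 + i%:Z by exists `|k - k0|%N; lia.
  have -> : k0 + i%:Z + 1 - k0 = i.+1 by lia.
  have -> : k0 + i%:Z - k0 = i by lia.
  by rewrite big_ord_recr.
have wL (i : nat) : w (k0 + i%:Z) = v *m theta (L (k0 + i%:Z)).
  elim: i => [|i IH].
    by rewrite L0 ?h0 ?mulmx_theta1 //; lia.
  have -> : k0 + i.+1%:Z = k0 + i%:Z + 1 by lia.
  rewrite LS; last by lia.
  by rewrite mulmx_thetaM -IH; case: (fP (k0 + i%:Z)).
exists L, (L (Num.max k0 k1)); split.
- by exists k0.
- move=> k; have [kk|kk] := leP k k0; first by rewrite L0 // mulmx_theta1 h0.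
  have [i ->] : exists i : nat, k = k0 + i%:Z by exists `|k - k0|%N; lia.
  exact: wL.
- move=> k; have [kk|kk] := leP k0 k.
    by rewrite LS // mulKg; case: (fP k).
  by rewrite !L0 ?mulVg; [exact: local1|lia|lia].
- exists (Num.max k0 k1) => k kk.
  have [i ->] : exists i : nat, k = Num.max k0 k1 + i%:Z.
    by exists `|k - Num.max k0 k1|%N; lia.
  elim: i => [|i IH]; first by congr L; lia.
  have -> : Num.max k0 k1 + i.+1%:Z = Num.max k0 k1 + i%:Z + 1 by lia.
  rewrite LS; last by lia.
  rewrite IH; case: (fP (Num.max k0 k1 + i%:Z)) => _ _ ->; first by rewrite mulg1.
  by rewrite !h1 //; lia.
Qed.

Lemma path_lift_end v' w L g : ga_path U v v' w -> path_lift w L g ->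
  v' = v *m theta g.
Proof.
move=> [_ _ [k1 h1]] [_ wL _ [j1 g1]].
by rewrite -(h1 (Num.max k1 j1)) ?wL ?g1 //; lia.
Qed.

(** The quotients of successive values of a lift form a list whose walk is the path
    up to a translation of time, and translations are homotopies. *)
Lemma path_lift_homotopic v' w L g : ga_path U v v' w -> path_lift w L g ->
  exists xs, [/\ locals xs, (\prod_(x <- xs) x)%g = g &
                 stably_homotopic U w (walk xs)].
Proof.
move=> pw [[k0 L0] wL Lloc [k1 L1]].
pose d := `|k0|%N; pose N := (`|k1| + d)%N.
pose l (i : nat) : St := L (i%:Z - d%:Z).
have l0 : l 0%N = 1%g by apply: L0; rewrite /d; lia.
pose xs := [seq ((l i)^-1 * l i.+1)%g | i <- iota 0 N].
have prodl k : (\prod_(x <- [seq ((l i)^-1 * l i.+1)%g | i <- iota 0 k]) x)%g = l k.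
  elim: k => [|k IH]; first by rewrite big_nil l0.
  by rewrite -[k.+1]addn1 iotaD map_cat big_cat /= IH big_seq1 add0n mulVKg addn1.
have lN i : (N <= i)%N -> l i = g by move=> Ni; apply: L1; rewrite /N in Ni; lia.
exists xs; split.
- move=> _ /mapP[i _ ->]; rewrite /l.
  have -> : i.+1%:Z - d%:Z = i%:Z - d%:Z + 1 by lia.
  exact: Lloc.
- by rewrite prodl lN.
have -> : walk xs = (fun k => w (k - d%:Z)); last exact: delay_homotopic pw.
apply/funext => -[i|i] /=; last by rewrite wL L0 ?mulmx_theta1 // /d; lia.
rewrite wL -/(l i) -map_take take_iota; congr (v *m theta _).
by rewrite prodl /minn; case: ifP => // iN; rewrite !lN //; lia.
Qed.

(** A walk only sees the rows v theta(g): an element of the list may be replaced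
    by another one leading to the same row, even if the product changes. *)
Lemma walk_replace us vs (g h : St) :
  v *m theta (\prod_(x <- us) x * g)%g = v *m theta (\prod_(x <- us) x * h)%g ->
  walk (us ++ g :: vs) = walk (us ++ h :: vs).
Proof.
move=> gh; apply/funext => -[i|//] /=; rewrite !take_cat; case: ifP => // _.
case: (i - size us)%N => // k.
by rewrite /= !big_cat /= !big_cons !mulgA mulmx_thetaM gh -mulmx_thetaM.
Qed.

End Walk.

End Frames.

(** * The fundamental group of elementary rows *)

Section FundamentalGroup.
Variables (R : pzRingType) (m : nat).
Local Notation St := (St R m.+1).
Local Notation row := 'rV[R]_m.+1.
Local Notation theta := (@theta R m.+1).
Local Notation e := (e1row R m).
Local Notation U := (EUm R m).
Local Notation Pt := (Pt R m).
Local Notation Pt2 := (Pt2 R m).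
Implicit Types (g h x y z : St) (a b : {set 'I_m.+1 * 'I_m.+1}).

Lemma En_theta g : En R m.+1 (theta g).
Proof. by rewrite -theta_En; exists g. Qed.

Lemma EUmP (v : row) : U v <-> exists g, v = e *m theta g.
Proof.
split=> [[h]|[g ->]]; last by exists (theta g) => //; apply: En_theta.
by rewrite -theta_En => -[g _ <-] <-; exists g.
Qed.

Lemma EUm_act (v : row) g : U v -> U (v *m theta g).
Proof. by move=> /EUmP[h ->]; apply/EUmP; exists (h * g)%g; rewrite mulmx_thetaM. Qed.

Lemma EUm_e : U e.
Proof. by apply/EUmP; exists 1%g; rewrite mulmx_theta1. Qed.

Lemma PtE g : Pt g <-> e *m theta g = e.
Proof. by split=> [[]//|h]; split=> //; apply: En_theta. Qed.

Lemma Pt_subgroup : subgroup Pt.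
Proof.
split=> [|x y|x]; rewrite !PtE ?mulmx_theta1 //.
  by move=> ex ey; rewrite mulmx_thetaM ex.
by move=> ex; rewrite -{1}ex mulmx_thetaK.
Qed.

Lemma Pt2_subgroup : subgroup Pt2.
Proof. exact: generated_subgroup. Qed.

Lemma Pt2_1 : Pt2 1%g. Proof. by case: Pt2_subgroup. Qed.

Lemma Pt2M x y : Pt2 x -> Pt2 y -> Pt2 (x * y)%g.
Proof. by case: Pt2_subgroup => _ + _; apply. Qed.

Lemma Pt2V x : Pt2 x -> Pt2 x^-1%g.
Proof. by case: Pt2_subgroup => _ _; apply. Qed.

(** The generators of Pt2 are the spurs: from the point e theta(g) along y to a
    neighbour, and back along z. *)
Lemma Pt2_spur g y z a b : nilpotent_set a -> nilpotent_set b ->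
  St_local R a y -> St_local R b z ->
  e *m theta (g * y * z)%g = e *m theta g -> Pt2 (g * (y * z) * g^-1)%g.
Proof.
move=> na nb ay bz ee; apply: sub_generated; split.
  by apply/PtE; rewrite !mulgA mulmx_thetaM ee mulmx_thetaK.
by exists g^-1%g, y, z, a, b; rewrite invgK.
Qed.

Lemma Pt2_spur1 g y a : nilpotent_set a -> St_local R a y ->
  e *m theta (g * y)%g = e *m theta g -> Pt2 (g * y * g^-1)%g.
Proof.
move=> na ay ee.
have := @Pt2_spur g y 1%g a a na na ay (@St_local1 _ _ a).
by rewrite !mulg1; apply.
Qed.

Lemma Pt2_normal g x : Pt g -> Pt2 x -> Pt2 (g * x * g^-1)%g.
Proof.
move=> Pg; have [P1 PM PV] := Pt_subgroup.
suff : Pt2 `<=` [set x | Pt2 (g * x * g^-1)%g] by apply.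
apply: generated_sub => [|p [Pp [t [y [z [a [b [[_ na ay nb bz] pE]]]]]]]].
  split=> [|p q|p] /=.
  - by rewrite mulg1 mulgV; apply: Pt2_1.
  - move=> h h'; have -> : (g * (p * q) * g^-1 = g * p * g^-1 * (g * q * g^-1))%g.
      by rewrite !mulgA mulgVK.
    exact: Pt2M.
  - move=> h; have -> : (g * p^-1 * g^-1 = (g * p * g^-1)^-1)%g.
      by rewrite !invgM invgK mulgA.
    exact: Pt2V.
apply: sub_generated; split; first exact: PM (PM _ _ Pg Pp) (PV _ Pg).
exists (t * g^-1)%g, y, z, a, b; split=> //.
by rewrite pE invgM invgK !mulgA.
Qed.

Lemma gcoset_Pt2 x y : Pt x -> gcoset x Pt2 = gcoset y Pt2 <-> Pt2 (x * y^-1)%g.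
Proof.
move=> Px; rewrite (subgroup_gcoset _ _ Pt2_subgroup).
have [P1 PM PV] := Pt_subgroup.
split=> h.
  have := Pt2_normal Px h; rewrite mulVKg => /Pt2V.
  by rewrite invgM invgK.
have := Pt2_normal (PV _ Px) h; rewrite invgK mulgA mulVg mul1g => /Pt2V.
by rewrite !invgM !invgK.
Qed.

(** Lifting a ladder of squares whose sides are w and w'. Far to the left the two
    lifts are 1. Across a square with local subgroup a, the sides and
    both rungs can be lifted inside a, where the square closes up exactly; the given
    lifts of the sides and of the next rung differ from those by spurs. The rung is
    universally quantified because consecutive squares lie in different local
    subgroups and induce different lifts of their common rung. *)
Lemma ladder_lift (w w' : int -> row) L L' x x' :
  path_lift e w L x -> path_lift e w' L' x' ->
  (forall j : int, square U (w j) (w (j + 1)) (w' j) (w' (j + 1))) ->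
  forall j : int, forall a z, nilpotent_set a -> St_local R a z ->
    w' j = w j *m theta z -> Pt2 (L j * z * (L' j)^-1)%g.
Proof.
move=> [[k0 L0] wL Lloc _] [[k0' L0'] wL' Lloc' _] sq.
have base (j : int) : j <= Num.min k0 k0' ->
    forall a z, nilpotent_set a -> St_local R a z ->
    w' j = w j *m theta z -> Pt2 (L j * z * (L' j)^-1)%g.
  move=> jk a z na az; rewrite wL wL' L0 ?L0' //; try lia.
  rewrite !mulmx_theta1 => ez; rewrite -(mul1g z).
  rewrite mul1g; have := @Pt2_spur1 1%g z a na az; rewrite mulmx_theta1 !mul1g.
  by apply; rewrite -ez.
move=> j; have [jk|jk] := leP j (Num.min k0 k0'); first exact: base.
have [i ->] : exists i : nat, j = Num.min k0 k0' + i%:Z.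
  by exists `|j - Num.min k0 k0'|%N; lia.
elim: i {j jk} => [|i IH]; first by apply: base; lia.
have -> : Num.min k0 k0' + i.+1%:Z = Num.min k0 k0' + i%:Z + 1 by lia.
move: (Num.min k0 k0' + i%:Z) IH => {i} j IH a' z' na' az' wz'.
have [Uj [a [na [x1 [ax1 wx1]] [z [az wz]] [u [au wu]]]]] := sq j.
have [b [nb bx]] := Lloc j; have [b' [nb' bx']] := Lloc' j.
have D0 := IH a z na az wz.
set X := L j in bx D0; set X1 := L (j + 1) in bx *.
set Y := L' j in bx' D0; set Y1 := L' (j + 1) in bx' *.
have eX : w j = e *m theta X by apply: wL.
have eX1 : w (j + 1) = e *m theta X1 by apply: wL.
have eY : w' j = e *m theta Y by apply: wL'.
have eY1 : w' (j + 1) = e *m theta Y1 by apply: wL'.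
(* x1, z and u lift in a the side of w, the rung at j and the diagonal; y and z2
   are then the side of w' and the rung at j + 1. *)
have e1 : e *m theta (X * x1)%g = e *m theta X1 by rewrite mulmx_thetaM -eX -eX1.
have e2 : e *m theta (X1 * z')%g = e *m theta Y1 by rewrite mulmx_thetaM -eX1 -eY1.
have e3 : e *m theta (X * z)%g = e *m theta Y by rewrite mulmx_thetaM -eX -eY.
have e4 : e *m theta (X * u)%g = e *m theta Y1 by rewrite mulmx_thetaM -eX -eY1.
pose y := (z^-1 * u)%g.
have back g h k : e *m theta (g * h)%g = e *m theta k ->
    e *m theta (k * h^-1)%g = e *m theta g.
  by move=> gh; rewrite mulmx_thetaM -gh -mulmx_thetaM mulgK.
have e5 : e *m theta (Y * y)%g = e *m theta Y1.
  by rewrite /y mulgA mulmx_thetaM (back X) // -mulmx_thetaM.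
have ay : St_local R a y by apply: St_localM => //; apply: St_localV.
pose z2 := (x1^-1 * u)%g.
have e6 : e *m theta (X1 * z2)%g = e *m theta Y1.
  by rewrite /z2 mulgA mulmx_thetaM (back X) // -mulmx_thetaM.
have az2 : St_local R a z2 by apply: St_localM => //; apply: St_localV.
have S1 : Pt2 (X1 * ((X^-1 * X1)^-1 * x1) * X1^-1)%g.
  apply: (@Pt2_spur _ _ _ b a) => //; first exact: St_localV.
  by rewrite invgM invgK !mulgA mulgV mul1g e1.
have S2 : Pt2 (X1 * (z' * z2^-1) * X1^-1)%g.
  apply: (@Pt2_spur _ _ _ a' a) => //; first exact: St_localV.
  by apply: (back); rewrite e6.
have S3 : Pt2 (Y1 * (y^-1 * (Y^-1 * Y1)) * Y1^-1)%g.
  apply: (@Pt2_spur _ _ _ a b') => //; first exact: St_localV.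
  by rewrite mulmx_thetaM (back Y) // -mulmx_thetaM mulVKg.
have -> : (X1 * z' * Y1^-1)%g =
   (X1 * (z' * z2^-1) * X1^-1 * (X1 * ((X^-1 * X1)^-1 * x1) * X1^-1)^-1
     * (X * z * Y^-1) * (Y1 * (y^-1 * (Y^-1 * Y1)) * Y1^-1)^-1)%g.
  rewrite /z2 /y !invgM !invgK !mulgA !(mulgK, mulgVK).
  by rewrite ?mulgV ?mul1g.
by apply: Pt2M (Pt2V S3); apply: Pt2M D0; apply: Pt2M S2 (Pt2V S1).
Qed.

(** Far to the right both loops have returned to e, and the rung lifts to 1. *)
Lemma ladder_end (w w' : int -> row) L L' x x' :
  loop U e w -> loop U e w' -> path_lift e w L x -> path_lift e w' L' x' ->
  (forall j : int, square U (w j) (w (j + 1)) (w' j) (w' (j + 1))) ->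
  Pt2 (x * x'^-1)%g.
Proof.
move=> [_ _ [k1 w1]] [_ _ [k1' w1']] Lw Lw' sq.
have [_ _ _ [j1 L1]] := Lw; have [_ _ _ [j1' L1']] := Lw'.
pose j := Num.max (Num.max k1 k1') (Num.max j1 j1').
have := @ladder_lift _ _ _ _ _ _ Lw Lw' sq j finset.set0 1%g (@nilpotent_set0 _).
rewrite L1 ?L1' ?mulg1; [|by rewrite /j; lia|by rewrite /j; lia].
apply; first exact: St_local1.
by rewrite mulmx_theta1 w1 ?w1' // /j; lia.
Qed.

(** Each row of a homotopy is a loop, and two consecutive rows form a ladder. *)
Lemma homotopic_lift (w w' : int -> row) L L' x x' :
  loop U e w -> path_lift e w L x -> path_lift e w' L' x' ->
  stably_homotopic U w w' -> Pt2 (x * x'^-1)%g.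
Proof.
move=> lw Lw Lw' [H [Hs [a [b Hp]] [k0 h0] [k1 h1]]].
have Hl k : loop U e (H ^~ k).
  have pk0 : ga_path U a b w by rewrite -(h0 k0).
  have [ea eb] := path_unique pk0 lw; subst a b; exact: Hp.
have row_step k M N y z : path_lift e (H ^~ k) M y ->
    path_lift e (H ^~ (k + 1)) N z -> Pt2 (y * z^-1)%g.
  move=> My Nz; apply: (ladder_end (Hl k) (Hl (k + 1)) My Nz) => j.
  exact/(squareP EUm_act H).
have rows (i : nat) M y : path_lift e (H ^~ (k0 + i%:Z)) M y -> Pt2 (x * y^-1)%g.
  elim: i M y => [|i IH] M y.
    rewrite h0 => [My|]; last by lia.
    apply: (ladder_end lw lw Lw My) => j.
    exact: (square_edge EUm_act (path_edge _ lw)).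
  have -> : k0 + i.+1%:Z = k0 + i%:Z + 1 by lia.
  move=> My; have [N [z Nz]] := path_lift_exists EUm_act (Hl (k0 + i%:Z)).
  have := Pt2M (IH _ _ Nz) (row_step _ _ _ _ _ Nz My).
  by rewrite mulgA mulgVK.
have [i ki] : exists i : nat, k1 <= k0 + i%:Z by exists `|k1 - k0|%N; lia.
by apply: (rows i L' x'); rewrite h1.
Qed.

Lemma loop_lift_Pt (w : int -> row) L x :
  loop U e w -> path_lift e w L x -> Pt x.
Proof. by move=> lw /(path_lift_end lw) ex; apply/PtE. Qed.

Lemma walk_loop (xs : seq St) : locals xs -> Pt (\prod_(x <- xs) x)%g ->
  loop U e (walk e xs).
Proof.
by move=> lx /PtE ex; have := walk_path EUm_act EUm_e lx; rewrite ex.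
Qed.

(** The elements that can be inserted in front of a walk without changing its
    homotopy class form a subgroup. It contains each spur g y z g^-1: replacing z by
    y^-1 changes no point of the walk, and then the inserted list has product 1. *)
Lemma Pt2_walk p : Pt2 p -> forall ps xs : seq St,
  locals ps -> locals xs -> (\prod_(x <- ps) x)%g = p ->
  stably_homotopic U (walk e (ps ++ xs)) (walk e xs).
Proof.
have mv (us us' xs : seq St) : locals us -> locals us' -> locals xs ->
    (\prod_(x <- us) x = \prod_(x <- us') x)%g ->
    stably_homotopic U (walk e (us ++ xs)) (walk e (us' ++ xs)).
  move=> lu lu' lx ee; have [_ _ _ h] := move_prod EUm_act EUm_e lu lu' ee.
  by apply: (h [::]).
have l0 : locals ([::] : seq St) by [].
pose D p := forall ps xs : seq St,
  locals ps -> locals xs -> (\prod_(x <- ps) x)%g = p ->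
  stably_homotopic U (walk e (ps ++ xs)) (walk e xs).
suff : Pt2 `<=` [set p | D p] by apply.
apply: generated_sub => [|q [/PtE qe [t [y [z [a [b [[_ na ay nb bz] qE]]]]]]]].
  split=> [|q r Dq Dr|q Dq] ps xs lp lx pE.
  - by apply: (mv _ [::]) => //; rewrite pE big_nil.
  - have [qs [lq qE]] := locals_of q; have [rs [lr rE]] := locals_of r.
    have lrx : locals (rs ++ xs) by apply/locals_cat.
    apply: (homotopic_trans EUm_act _ (Dr rs _ lr lx rE)).
    apply: (homotopic_trans EUm_act _ (Dq qs _ lq lrx qE)).
    rewrite catA; apply: mv => //; first exact/locals_cat.
    by rewrite big_cat /= qE rE.
  - have [qs [lq qE]] := locals_of q.
    have lpx : locals (ps ++ xs) by apply/locals_cat.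
    apply: (homotopic_trans EUm_act (homotopic_sym EUm_act (Dq qs _ lq lpx qE))).
    rewrite catA; apply: (mv _ [::]) => //; first exact/locals_cat.
    by rewrite big_cat /= qE pE mulgV big_nil.
move=> ps xs lp lx pE.
have [us [lu uE]] := locals_of t^-1%g; have [ts [lt tE]] := locals_of t.
have ly : local y by exists a.
have lz : local z by exists b.
have ly' : local y^-1%g by exists a; split=> //; apply: St_localV.
have l2 c : local c -> locals [:: y; c].
  by move=> lc g; rewrite !inE => /orP[] /eqP ->.
have l4 c : local c -> locals (us ++ [:: y; c] ++ ts).
  by move=> lc; apply/locals_cat; split=> //; apply/locals_cat; split=> //; apply: l2.
apply: (homotopic_trans EUm_act (w' := walk e ((us ++ [:: y; z] ++ ts) ++ xs))).
  apply: mv => //; first exact: l4.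
  by rewrite pE qE !big_cat /= uE tE big_cons big_seq1 !mulgA.
have -> : walk e ((us ++ [:: y; z] ++ ts) ++ xs) =
    walk e ((us ++ [:: y; y^-1%g] ++ ts) ++ xs).
  have E c : (us ++ [:: y; c] ++ ts) ++ xs = (us ++ [:: y]) ++ c :: (ts ++ xs).
    by rewrite -!catA.
  rewrite !E; apply: walk_replace.
  rewrite !big_cat /= !big_seq1 uE mulgK.
  rewrite -[in RHS]qe -mulmx_thetaM qE.
  by rewrite !mulgA mulgK.
apply: (mv _ [::]) => //; first exact: l4.
by rewrite !big_cat /= uE tE big_cons big_seq1 mulgV mul1g mulVg big_nil.
Qed.

(** Modulo homotopy the two loops are walks, whose products differ by an element
    of Pt2; lists with the same product have homotopic walks. *)
Lemma lift_homotopic (w w' : int -> row) L L' x x' :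
  loop U e w -> loop U e w' -> path_lift e w L x -> path_lift e w' L' x' ->
  Pt2 (x * x'^-1)%g -> stably_homotopic U w w'.
Proof.
move=> lw lw' Lw Lw' P.
have [xs [lx xE hw]] := path_lift_homotopic EUm_act lw Lw.
have [xs' [lx' xE' hw']] := path_lift_homotopic EUm_act lw' Lw'.
have [ps [lp pE]] := locals_of (x * x'^-1)%g.
apply: (homotopic_trans EUm_act hw).
apply: (homotopic_trans EUm_act _ (homotopic_sym EUm_act hw')).
apply: (homotopic_trans EUm_act _ (Pt2_walk P lp lx' pE)).
have lpx : locals (ps ++ xs') by apply/locals_cat.
have ee : (\prod_(y <- xs) y = \prod_(y <- ps ++ xs') y)%g.
  by rewrite big_cat /= pE xE xE' mulgVK.
have [_ _ _ h] := move_prod EUm_act EUm_e lx lpx ee.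
by have := h [::] [::]; rewrite /= !cats0; apply.
Qed.

End FundamentalGroup.

(** ** Stabilizer of the first basis row *)

Section Stabilizer.
Variables (R : pzRingType) (m : nat).
Local Notation St := (St R m.+1).
Local Notation theta := (@theta R m.+1).
Local Notation e := (e1row R m).
Implicit Types (s : GL R m.+1) (t : GL R m) (v : 'cV[R]_m).

(** The data of a generator of EPn2 lift to the Steinberg group, and Pt is the full
    preimage of EPn, so the lift is a generator of Pt2. *)
Lemma theta_Pt2 : theta @` Pt2 R m = @EPn2 R m.
Proof.
apply: morph_generated; first exact: thetaM.
have thE x y z : theta (x^-1 * (y * z) * x)%g =
    ((theta x)^-1 * (theta y * theta z) * theta x)%g by rewrite !thetaM thetaV.
apply/seteqP; split=> [_ [p [Pp [x [y [z [a [b [[_ na ay nb bz] pE]]]]]]] <-]|g].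
  split; first exact: Pp.
  exists (theta x), (theta y), (theta z), a, b; rewrite pE thE; split=> //.
  split=> //; first exact: En_theta.
    by rewrite -theta_St_local; exists y.
  by rewrite -theta_St_local; exists z.
move=> [Pg [x [y [z [a [b [[+ na + nb +] gE]]]]]]].
rewrite -theta_En -!theta_St_local => -[x' _ xE] [y' ay yE] [z' bz zE].
exists (x'^-1 * (y' * z') * x')%g; last by rewrite thE xE yE zE.
split; first by rewrite /Defs.Pt /= thE xE yE zE -gE.
by exists x', y', z', a, b.
Qed.

Lemma EPn_subgroup : subgroup (@EPn R m).
Proof.
apply: subgroupI; last exact: generated_subgroup.
split=> [|x y|x]; rewrite /Pn /=.
- by rewrite mulmx1.
- by move=> ex ey; rewrite mulmxA ex.
- by move=> ex; rewrite -{1}ex -mulmxA GLmulmxV mulmx1.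
Qed.

Lemma EPn2_subgroup : subgroup (@EPn2 R m).
Proof. exact: generated_subgroup. Qed.

Lemma EPn2_sub_EPn : @EPn2 R m `<=` @EPn R m.
Proof. by apply: generated_sub; [exact: EPn_subgroup|move=> g []]. Qed.

Lemma embedE t : (embed t : 'M[R]_(1 + m)) = block_mx 1 0 0 t.
Proof. by []. Qed.

Lemma embedM : {morph @embed R m : s t / (s * t)%g}.
Proof.
move=> s t; apply: GL_inj; apply: esym.
rewrite -[LHS]/((embed s : 'M[R]_(1 + m)) *m (embed t : 'M[R]_(1 + m))).
by rewrite !embedE mulmx_block !mulmx0 !mul0mx !addr0 !add0r mulmx1.
Qed.

Lemma Pn_of_block s v (A : 'M[R]_m) :
  (s : 'M[R]_(1 + m)) = block_mx 1 0 v A -> @Pn R m s.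
Proof.
move=> sE; rewrite /Pn /= -rowE.
have z : 0 = lshift m (0 : 'I_1) :> 'I_(1 + m) by apply: val_inj.
apply/rowP => j; rewrite [LHS]mxE sE [RHS]mxE eqxx /=.
case: (@split_ordP 1 m j) => k ->; rewrite z.
  by rewrite (block_mxEul (1 : 'M[R]_1) (0 : 'M[R]_(1, m)) v A) mxE !ord1 eqxx.
by rewrite (block_mxEur (1 : 'M[R]_1) (0 : 'M[R]_(1, m)) v A) mxE.
Qed.

(** The inverse has the same block form, which makes the lower right corner
    invertible. *)
Lemma Pn_block s : @Pn R m s ->
  exists v t, (s : 'M[R]_(1 + m)) = block_mx 1 0 v t.
Proof.
have blk (s' : GL R m.+1) : @Pn R m s' ->
    (s' : 'M[R]_(1 + m)) =
    block_mx 1 0 (dlsubmx (s' : 'M[R]_(1 + m))) (drsubmx (s' : 'M[R]_(1 + m))).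
  rewrite /Pn /= -rowE => /rowP h.
  apply: etrans (esym (submxK (s' : 'M[R]_(1 + m)))) _.
  have z : 0 = lshift m (0 : 'I_1) :> 'I_(1 + m) by apply: val_inj.
  congr block_mx; apply/matrixP => i j; rewrite !mxE !ord1.
    by have := h 0; rewrite !mxE -!z => ->.
  have := h (rshift 1 j); rewrite !mxE -!z => ->.
  by [].
move=> Ps; have PVs : @Pn R m s^-1%g.
  by rewrite /Pn /= -{1}Ps -mulmxA GLmulmxV mulmx1.
have bs := blk _ Ps; have bV := blk _ PVs.
set d := drsubmx (s : 'M[R]_(1 + m)) in bs.
set d' := drsubmx (s^-1%g : 'M[R]_(1 + m)) in bV.
have e1 : 1%:M = block_mx 1 0 0 1%:M :> 'M[R]_(1 + m).
  by rewrite [LHS]scalar_mx_block.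
have inv : `[< mx_invertible d >].
  apply/asboolP; exists d'.
  have h1 : (s : 'M[R]_(1 + m)) *m (s^-1%g : 'M[R]_(1 + m)) = 1%:M by exact: GLmulmxV.
  have h2 : (s^-1%g : 'M[R]_(1 + m)) *m (s : 'M[R]_(1 + m)) = 1%:M by exact: GLmulVmx.
  move: h1 h2; rewrite bs bV !mulmx_block e1.
  rewrite !mulmx0 !add0r => /eq_block_mx[_ _ _ ->] /eq_block_mx[_ _ _ ->].
  by [].
by exists (dlsubmx (s : 'M[R]_(1 + m))), (MkGL inv).
Qed.

Definition column0 : {set 'I_m.+1 * 'I_m.+1} :=
  [set p | (p.1 != 0) && (p.2 == 0)]%SET.

Lemma column0_nilpotent : nilpotent_set column0.
Proof.
split=> [|i j|i j k].
- by apply/fintype.subsetP => -[i j]; rewrite !finset.inE /= => /andP[i0 /eqP->].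
- by rewrite !finset.inE /= => /andP[_ /eqP->]; rewrite eqxx.
- by rewrite !finset.inE /= => /andP[_ /eqP->]; rewrite eqxx.
Qed.

(** These matrices form a group isomorphic to the additive group of columns, which
    is generated by the columns with one nonzero entry. *)
Lemma lower_En_local v : exists s,
  En_local R column0 s /\ (s : 'M[R]_(1 + m)) = block_mx 1 0 v 1%:M.
Proof.
have [G1 GM _] : subgroup (En_local R column0) by apply: En_local_subgroup.
have -> : v = \sum_i v i 0 *: delta_mx i 0.
  apply/colP => i; rewrite summxE (bigD1 i) //= big1 => [|j ji].
    by rewrite !mxE !eqxx mulr1 addr0.
  by rewrite !mxE eq_sym (negbTE ji) mulr0.
elim/big_ind: _ => [|x y [s [ls sE]] [s' [ls' s'E]]|i _].
- exists 1%g; split=> //.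
  have e1 : 1%:M = block_mx 1 0 0 1%:M :> 'M[R]_(1 + m).
    by rewrite [LHS]scalar_mx_block.
  exact: e1.
- exists (s * s')%g; split; first exact: GM.
  rewrite -[LHS]/((s : 'M[R]_(1 + m)) *m (s' : 'M[R]_(1 + m))) sE s'E mulmx_block.
  by rewrite !mulmx0 !mul0mx !addr0 !add0r !mulmx1 mul1mx.
have i0 : rshift 1 i != 0 :> 'I_m.+1 by [].
exists (elem i0 (v i 0)); split.
  apply: sub_generated; exists (rshift 1 i), 0, i0, (v i 0); split=> //.
  by rewrite finset.inE.
have e1 : 1%:M = block_mx 1 0 0 1%:M :> 'M[R]_(1 + m).
  by rewrite [LHS]scalar_mx_block.
have z : 0 = lshift m (0 : 'I_1) :> 'I_(1 + m) by apply: val_inj.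
rewrite -[LHS]/((1%:M : 'M[R]_(1 + m)) + v i 0 *: delta_mx (rshift 1 i) (0 : 'I_(1 + m))).
have dE : delta_mx (rshift 1 i) (lshift m 0) = block_mx 0 0 (delta_mx i 0) 0
    :> 'M[R]_(1 + m).
  apply/matrixP => p q; case: (split_ordP p) => p' ->;
    case: (split_ordP q) => q' ->;
    rewrite ?block_mxEul ?block_mxEur ?block_mxEdl ?block_mxEdr !mxE
      ?eq_lshift ?eq_rshift ?eq_lrshift ?eq_rlshift ?andbF //.
rewrite z dE e1 scale_block_mx add_block_mx !scaler0 !addr0.
by rewrite add0r.
Qed.

Lemma En_local_sub_En a : En_local R a `<=` En R m.+1.
Proof.
apply: generated_sub; first exact: generated_subgroup.
by move=> _ [i [j [ij [r [_ ->]]]]]; apply: sub_generated; exists i, j, ij, r.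
Qed.

Lemma lower_EPn2 (s : GL R m.+1) v :
  En_local R column0 s -> (s : 'M[R]_(1 + m)) = block_mx 1 0 v 1%:M -> @EPn2 R m s.
Proof.
move=> ls sE; apply: sub_generated; split.
  by split; [apply: Pn_of_block sE|apply: En_local_sub_En ls].
exists 1%g, s, 1%g, column0, column0; split.
  split; [|exact: column0_nilpotent|by []|exact: column0_nilpotent|].
    by case: (@En_subgroup R m.+1).
  by case: (@En_local_subgroup R m.+1 column0).
by rewrite invg1 mul1g !mulg1.
Qed.

(** The factor u has first column t^-1 v below the diagonal and is otherwise the
    identity. It lies in a single local group and fixes the first basis row,
    so it is itself a generator of EPn2. *)
Lemma Pn_factor s v t : (s : 'M[R]_(1 + m)) = block_mx 1 0 v t ->
  exists u, @EPn2 R m u /\ s = (embed t * u)%g.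
Proof.
move=> sE.
have [u [lu uE]] := lower_En_local (GLinvmx t *m v).
exists u; split; first exact: lower_EPn2 lu uE.
apply: GL_inj; rewrite -[RHS]/((embed t : 'M[R]_(1 + m)) *m (u : 'M[R]_(1 + m))).
rewrite sE uE embedE mulmx_block !mulmx0 !mul0mx !addr0 !add0r !mulmx1.
by rewrite mulmxA GLmulmxV mul1mx.
Qed.

End Stabilizer.

(** ** Path lifting identifies the fundamental group *)

Section Identification.
Variables (R : pzRingType) (m : nat).
Local Notation St := (St R m.+1).
Local Notation row := 'rV[R]_m.+1.
Local Notation theta := (@theta R m.+1).
Local Notation e := (e1row R m).
Local Notation U := (EUm R m).
Local Notation Pt := (Pt R m).
Local Notation Pt2 := (Pt2 R m).
Local Notation act := (@EUm_act R m).
Implicit Types (g h x y z : St) (w : int -> row).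

(** All lifted end points of all loops of C: no representative is chosen, and the
    value on a homotopy class is a single coset. *)
Definition lift_class (C : set (int -> row)) : set St :=
  [set y | exists w L x, [/\ C w, loop U e w, path_lift e w L x & gcoset x Pt2 y]].

Lemma loop_homotopic_refl w : loop U e w -> stably_homotopic U w w.
Proof. exact: (homotopic_refl act). Qed.

Lemma loop_class_eq w w' : loop U e w -> loop U e w' ->
  loop_class U e w = loop_class U e w' <-> stably_homotopic U w w'.
Proof.
move=> lw lw'; split=> [ee|ww'].
  have : loop_class U e w' w' by split=> //; apply: loop_homotopic_refl.
  by rewrite -ee => -[].
apply/seteqP; split=> u [lu h]; split=> //.
  exact: (homotopic_trans act (homotopic_sym act ww') h).
exact: (homotopic_trans act ww' h).
Qed.

Lemma lift_gcoset w w' L L' x x' : loop U e w -> loop U e w' ->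
  path_lift e w L x -> path_lift e w' L' x' ->
  gcoset x Pt2 = gcoset x' Pt2 <-> stably_homotopic U w w'.
Proof.
move=> lw lw' Lw Lw'; rewrite gcoset_Pt2; last exact: loop_lift_Pt lw Lw.
split; first exact: lift_homotopic lw lw' Lw Lw'.
exact: homotopic_lift lw Lw Lw'.
Qed.

Lemma gcoset_refl x : gcoset x Pt2 x.
Proof. by exists 1%g; [exact: Pt2_1|rewrite mulg1]. Qed.

Lemma gcoset_eq x y : gcoset x Pt2 y -> gcoset x Pt2 = gcoset y Pt2.
Proof.
move=> [p Pp <-]; apply/(subgroup_gcoset _ _ (@Pt2_subgroup R m)).
by rewrite mulKg.
Qed.

Lemma lift_classE w L x : loop U e w -> path_lift e w L x ->
  lift_class (loop_class U e w) = gcoset x Pt2.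
Proof.
move=> lw Lw; apply/seteqP; split=> [y [w' [L' [x' [[_ ww'] lw' Lw' xy]]]]|y xy].
  by rewrite (proj2 (lift_gcoset lw lw' Lw Lw') ww').
by exists w, L, x; split=> //; split=> //; apply: loop_homotopic_refl.
Qed.

Lemma lifts_path_lift w (xs : seq St) : lifts w xs ->
  exists L, path_lift e w L (\prod_(x <- xs) x)%g.
Proof.
move=> [lx [k0 [w0 wk]]].
have := walk_lift e lx; set L := (L in path_lift _ _ L _).
move=> [[j0 L0] wL Lloc [j1 L1]].
exists (fun k => L (k - k0)); split.
- by exists (j0 + k0) => k kj; apply: L0; lia.
- move=> k; rewrite -wL; case E: (k - k0) => [i|i] /=.
    by rewrite -wk; congr w; lia.
  by apply: w0; lia.
- move=> k; have -> : k + 1 - k0 = k - k0 + 1 by lia.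
  exact: Lloc.
- by exists (j1 + k0) => k kj; apply: L1; lia.
Qed.

Lemma loop_lift_exists w : loop U e w -> exists L x, path_lift e w L x.
Proof. exact: (path_lift_exists act). Qed.

Lemma Pt_loop x : Pt x -> exists w L, loop U e w /\ path_lift e w L x.
Proof.
move=> Px; have [xs [lx xE]] := locals_of x.
exists (walk e xs); eexists; split.
  by apply: walk_loop => //; rewrite xE.
by rewrite -xE; apply: walk_lift.
Qed.

Lemma lift_class_bij :
  set_bij (pi1 U e) (Pt_quot R m) lift_class.
Proof.
split.
- move=> _ [w lw <-]; have [L [x Lw]] := loop_lift_exists lw.
  by rewrite (lift_classE lw Lw); exists x => //; apply: loop_lift_Pt lw Lw.
- move=> _ _ /set_mem[w lw <-] /set_mem[w' lw' <-].
  have [L [x Lw]] := loop_lift_exists lw.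
  have [L' [x' Lw']] := loop_lift_exists lw'.
  rewrite (lift_classE lw Lw) (lift_classE lw' Lw') => ee.
  exact/(loop_class_eq lw lw')/(lift_gcoset lw lw' Lw Lw').
move=> _ [x Px <-]; have [w [L [lw Lw]]] := Pt_loop Px.
by exists (loop_class U e w); [exists w|apply: lift_classE lw Lw].
Qed.

Lemma concatenation_loop w w' w'' : loop U e w -> loop U e w' ->
  concatenation e w w' w'' -> loop U e w''.
Proof.
move=> [ew [k0 w0] _] [ew' _ [k1 w1]] [j [k [wj w'k e1 e2]]]; split.
- move=> i; have [ij|ij] : i < j \/ j <= i by lia.
    by rewrite !e1; [exact: ew|lia|lia].
  rewrite !e2; try lia.
  have -> : i + 1 - j + k = i - j + k + 1 by lia.
  exact: ew'.
- by exists (Num.min k0 j) => i ij; rewrite e1 ?w0 //; lia.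
- by exists (Num.max j (k1 + j - k)) => i ij; rewrite e2 ?w1 //; lia.
Qed.

Lemma concatenation_exists w w' : loop U e w -> loop U e w' ->
  exists w'', concatenation e w w' w''.
Proof.
move=> [_ _ [j wj]] [_ [k w'k] _].
exists (fun i => if i <= j then w i else w' (i - j + k)).
exists j, k; split=> // i ij; first by rewrite ij.
case: ifP => // ij'; rewrite wj // w'k //; lia.
Qed.

(** A lift of w need not be stationary from time j on, although w is. It is
    therefore cut off at time j, and a lift of w' is normalized to be 1 up to time
    k; the two then fit together. *)
Lemma concatenation_lift w w' w'' : loop U e w -> loop U e w' ->
  concatenation e w w' w'' -> exists L L' L'' x x',
  [/\ path_lift e w L x, path_lift e w' L' x' & path_lift e w'' L'' (x * x')%g].
Proof.
move=> lw lw' [j [k [wj w'k e1 e2]]].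
have [L [x [[k0 L0] wL Lloc [k1 L1]]]] := loop_lift_exists lw.
have [M [y [[k0' M0] wM Mloc [k1' M1]]]] := loop_lift_exists lw'.
have eL : e *m theta (L j) = e by rewrite -wL wj.
have eM : e *m theta (M k) = e by rewrite -wM w'k.
have eMV : e *m theta (M k)^-1%g = e by rewrite -{1}eM mulmx_thetaK.
exists (fun i => L (Num.min i j)), (fun i => (M k)^-1 * M (Num.max i k))%g.
exists (fun i => if (i <= j)%R then L i else L j * ((M k)^-1 * M (i - j + k)%R))%g.
exists (L j), ((M k)^-1 * y)%g; split; split.
- exists (Num.min k0 j) => i ij; apply: L0; lia.
- move=> i; have [ij|ij] := leP i j; first exact: wL.
  by rewrite eL wj //; lia.
- move=> i; have [ij|ij] : i < j \/ j <= i by lia.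
    have -> : Num.min i j = i by lia.
    have -> : Num.min (i + 1) j = i + 1 by lia.
    exact: Lloc.
  have -> : Num.min i j = j by lia.
  have -> : Num.min (i + 1) j = j by lia.
  by rewrite mulVg; apply: local1.
- by exists j => i ij; congr L; lia.
- exists k => i ik; have -> : Num.max i k = k by lia.
  exact: mulVg.
- move=> i; rewrite mulmx_thetaM eMV -wM; have [ik|ik] := leP i k => //.
  by rewrite !w'k //; lia.
- move=> i; rewrite invgM invgK mulgA mulgK.
  have [ik|ik] : i < k \/ k <= i by lia.
    have -> : Num.max i k = k by lia.
    have -> : Num.max (i + 1) k = k by lia.
    by rewrite mulVg; apply: local1.
  have -> : Num.max i k = i by lia.
  have -> : Num.max (i + 1) k = i + 1 by lia.
  exact: Mloc.
- by exists (Num.max k1' k) => i ik; rewrite (M1 (Num.max i k)) //; lia.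
- exists (Num.min k0 j) => i ij.
  have -> : i <= j by lia.
  by apply: L0; lia.
- move=> i; case: ifP => ij; first by rewrite e1.
  rewrite e2; last by move: ij => /negbT; lia.
  by rewrite mulmx_thetaM eL mulmx_thetaM eMV -wM.
- move=> i; have [ij|[ij|ij]] : i < j \/ i = j \/ j < i by lia.
  + have -> : i <= j by lia.
    have -> : i + 1 <= j by lia.
    exact: Lloc.
  + rewrite ij lexx; have -> : (j + 1 <= j) = false by lia.
    have -> : j + 1 - j + k = k + 1 by lia.
    by rewrite mulKg; apply: Mloc.
  + have -> : (i <= j) = false by lia.
    have -> : (i + 1 <= j) = false by lia.
    have -> : i + 1 - j + k = i - j + k + 1 by lia.
    rewrite !invgM !invgK !mulgA mulgVK mulgK.
    exact: Mloc.
- exists (Num.max (j + 1) (k1' + j - k)) => i ij.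
  have -> : (i <= j) = false by lia.
  by rewrite (M1 (i - j + k)) //; lia.
Qed.

Lemma lift_class_mul A B : pi1 U e A -> pi1 U e B ->
  lift_class (pi1_mul U e A B) = setprod (lift_class A) (lift_class B).
Proof.
move=> [a la <-] [b lb <-]; apply/seteqP; split.
  move=> y [w [L [x [[w1 [w2 [w3 [A1 A2 con ww3]]]] lw Lw xy]]]].
  have [l1 _] := A1; have [l2 _] := A2.
  have l3 := concatenation_loop l1 l2 con.
  have [L1 [L2 [L3 [x1 [x2 [Lw1 Lw2 Lw3]]]]]] := concatenation_lift l1 l2 con.
  move: xy; rewrite -(proj2 (lift_gcoset l3 lw Lw3 Lw)); last by case: ww3.
  move=> [p Pp <-]; exists (x1, (x2 * p)%g) => /=; last by rewrite mulgA.
  split; first by exists w1, L1, x1; split=> //; apply: gcoset_refl.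
  by exists w2, L2, x2; split=> //; exists p.
move=> _ [[y1 y2] [/= [w1 [L1 [x1 [A1 l1 Lw1 xy1]]]] [w2 [L2 [x2 [A2 l2 Lw2 xy2]]]]] <-].
have [w3 con] := concatenation_exists l1 l2.
have l3 := concatenation_loop l1 l2 con.
have [M1 [M2 [M3 [z1 [z2 [Mw1 Mw2 Mw3]]]]]] := concatenation_lift l1 l2 con.
exists w3, M3, (z1 * z2)%g; split=> //.
  by exists w1, w2, w3; split=> //; split=> //; apply: loop_homotopic_refl.
have [p1 P1 <-] : gcoset z1 Pt2 y1.
  by rewrite (proj2 (lift_gcoset l1 l1 Mw1 Lw1)) //; apply: loop_homotopic_refl.
have [p2 P2 <-] : gcoset z2 Pt2 y2.
  by rewrite (proj2 (lift_gcoset l2 l2 Mw2 Lw2)) //; apply: loop_homotopic_refl.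
have Pz2 : Pt z2^-1%g.
  by have [_ _ PV] := @Pt_subgroup R m; apply/PV/(loop_lift_Pt l2 Mw2).
exists (z2^-1 * p1 * z2 * p2)%g.
  by apply: Pt2M P2; have := Pt2_normal Pz2 P1; rewrite invgK.
by rewrite !mulgA mulgK.
Qed.

End Identification.

(** * The orbit set of unimodular rows and the first sequence *)

Section OrbitSet.
Variables (R : pzRingType) (n : nat).

Lemma Um_GL (v : 'rV[R]_n) (s : GL R n) : Um R n v -> Um R n (v *m s).
Proof.
move=> [c vc]; exists (fun i => (GLinvmx s *m (\col_j c j)) i 0).
transitivity ((v *m s *m (GLinvmx s *m (\col_j c j))) 0 0).
  by rewrite [RHS]mxE.
rewrite mulmxA -(mulmxA v) GLmulmxV mulmx1 mxE -vc.
by apply: eq_bigr => i _; rewrite mxE.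
Qed.

Lemma pi0_classE (v : 'rV[R]_n) : Um R n v ->
  pi0_class (Um R n) v = [set v *m h | h in En R n].
Proof.
have act (x : 'rV[R]_n) (g : St R n) : Um R n x -> Um R n (x *m theta g).
  exact: Um_GL.
move=> Uv; apply/seteqP; split=> [u [Uu [w pw]]|_ [h + <-]].
  have [L [g Lw]] := path_lift_exists act pw.
  exists (theta g); first by rewrite -theta_En; exists g.
  by rewrite (path_lift_end pw Lw).
rewrite -theta_En => -[g _ <-] {h}; split; first exact: Um_GL.
have [xs [lx <-]] := locals_of g.
by exists (walk v xs); apply: (walk_path act).
Qed.

End OrbitSet.

Section FirstSequence.
Variables (R : pzRingType) (m : nat).
Local Notation e := (e1row R m).
Local Notation Um := (Um R m.+1).

(** The three maps of the first sequence collect values over the whole given class,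
    so that no choice of representatives is involved. *)
Definition orbit_map (C : set (GL R m.+1)) : set 'rV[R]_m.+1 :=
  [set e *m s | s in C].

Definition kernel_map (X : set 'rV[R]_m.+1) : module_class R :=
  fun N => exists v, X v /\ isom (ker_row v) N.

Definition stabilization_map (C : module_class R) : module_class R :=
  fun N => exists M, C M /\ isom (M * (R^c)^o)%type N.

Lemma GL_Um (s : GL R m.+1) : Um (e *m s).
Proof. exact/Um_GL/e1row_Um. Qed.

Lemma orbit_mapE (s : GL R m.+1) :
  orbit_map (gcoset s (En R m.+1)) = pi0_class Um (e *m s).
Proof.
rewrite pi0_classE; last exact: GL_Um.
apply/seteqP; split=> [_ [_ [h Eh <-] <-]|_ [h Eh <-]].
  by exists h => //=; rewrite mulmxA.
by exists (s * h)%g; [exists h|rewrite /= mulmxA].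
Qed.

Lemma kernel_mapE (v : 'rV[R]_m.+1) : Um v ->
  kernel_map (pi0_class Um v) = iso_class (ker_row v).
Proof.
move=> Uv; rewrite pi0_classE //; apply/funext => N; apply/propext; split.
  move=> [_ [[h _ <-]]]; apply: isom_trans.
  exact/isom_sym/isom_ker_row_mulmx.
move=> vN; exists v; split=> //; exists 1%g; last by rewrite mulmx1.
by case: (@En_subgroup R m.+1).
Qed.

Lemma stabilization_mapE (M : lmodType R^c) :
  stabilization_map (iso_class M) = iso_class (M * (R^c)^o)%type.
Proof.
apply/funext => N; apply/propext; split=> [[M' [MM' h]]|h].
  apply: isom_trans h; exact: isom_prod MM' (isom_refl _).
by exists M; split=> //; apply: isom_refl.
Qed.

Lemma first_sequence :
  [/\ pointed_map (K1 R m.+1) (pi0 Um e) orbit_map,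
      pointed_map (pi0 Um e) (K0s R m) kernel_map,
      pointed_map (K0s R m) (K0s R m.+1) stabilization_map,
      exact_at (K1 R m.+1) (pi0 Um e) (K0s R m) orbit_map kernel_map
    & exact_at (pi0 Um e) (K0s R m) (K0s R m.+1) kernel_map stabilization_map].
Proof.
have Ue := @e1row_Um R m.
have e1 : e *m (1%g : GL R m.+1) = e by rewrite /= mulmx1.
have K1_base : K1 R m.+1 (pbase (K1 R m.+1)) by exists 1%g.
have pi0_base : pi0 Um e (pbase (pi0 Um e)) by exists e.
have K0s_base k : K0s R k (pbase (K0s R k)).
  by exists 'cV[R^c]_k; split=> //; apply/K0s_moduleE/stably_free_free.
have ker_e : iso_class (ker_row e) = iso_class 'cV[R^c]_m.
  exact/iso_classP/isom_ker_row_e1row.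
split; first split=> //.
- by move=> _ [s _ <-]; exists (e *m s); [apply: GL_Um|rewrite orbit_mapE].
- by rewrite /= orbit_mapE e1.
- split=> //.
    move=> _ [v Uv <-]; exists (ker_row v); rewrite kernel_mapE //; split=> //.
    exact/K0s_moduleE/stably_free_of_prod_regular/isom_ker_row_split.
  by rewrite /= kernel_mapE.
- split=> //.
    move=> _ [M [/K0s_moduleE sM <-]]; rewrite stabilization_mapE.
    exists (M * (R^c)^o)%type; split=> //.
    exact/K0s_moduleE/stably_free_regular.
  rewrite /= stabilization_mapE; apply/iso_classP/isom_col_regular_prod.
- move=> _ [v Uv <-]; rewrite kernel_mapE //; split=> /=.
    move=> /iso_classP /(completable_of_free_ker Uv)[s sv].
    by exists (gcoset s (En R m.+1)); split; [exists s|rewrite orbit_mapE sv].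
  move=> [_ [[s _ <-]]]; rewrite orbit_mapE => /(congr1 kernel_map).
  rewrite !kernel_mapE //; last exact: GL_Um.
  move=> <-; apply/iso_classP; apply: isom_trans (isom_ker_row_mulmx _ _) _.
  exact: isom_ker_row_e1row.
move=> _ [P [/K0s_moduleE sP <-]]; rewrite stabilization_mapE; split=> /=.
  move=> /iso_classP /ker_row_of_split[v [Uv kv]].
  exists (pi0_class Um v); split; first by exists v.
  by rewrite kernel_mapE //; apply/iso_classP.
move=> [_ [[v Uv <-]]]; rewrite kernel_mapE // => /iso_classP kP.
apply/iso_classP; apply: isom_trans (isom_ker_row_split Uv).
exact: isom_prod (isom_sym kP) (isom_refl _).
Qed.

End FirstSequence.

(** * The second sequence *)

Section SecondSequence.
Variables (R : pzRingType) (m : nat).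
Local Notation St := (St R m.+1).
Local Notation row := 'rV[R]_m.+1.
Local Notation theta := (@theta R m.+1).
Local Notation e := (e1row R m).
Local Notation U := (EUm R m).
Local Notation Pt := (Pt R m).
Local Notation Pt2 := (Pt2 R m).
Local Notation GLEP2 := (GLEP2 R m).
Local Notation pi1 := (pi1 U e).
Implicit Types (Y Z : St) (t : GL R m) (v : 'cV[R]_m).

Definition loops_over Y : set (int -> row) :=
  [set w | exists L x, [/\ loop U e w, path_lift e w L x & gcoset x Pt2 Y]].

(** The class of t does not depend on the lift Y ([corner_gcoset]). *)
Definition corner_map (A : set (int -> row)) : set (GL R m) :=
  [set s | exists Y v t, [/\ Pt Y, lift_class A = gcoset Y Pt2,
     (theta Y : 'M[R]_(1 + m)) = block_mx 1 0 v t & gcoset t GLEP2 s]].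

Definition embed_map (C : set (GL R m)) : set (GL R m.+1) :=
  setprod (@embed R m @` C) (En R m.+1).

Lemma embed1 : embed (1%g : GL R m) = 1%g.
Proof. exact: morph_group1 (@embedM R m). Qed.

Lemma embedV t : embed t^-1%g = (embed t)^-1%g.
Proof. exact: morph_groupV (@embedM R m) t. Qed.

Lemma GLEP2_subgroup : subgroup GLEP2.
Proof.
have [E1 EM EV] := @EPn2_subgroup R m.
split=> [|s t|s]; rewrite /Defs.GLEP2 /= ?embed1 ?embedM ?embedV //.
  exact: EM.
exact: EV.
Qed.

Lemma loops_overE w L Y : loop U e w -> path_lift e w L Y ->
  loops_over Y = loop_class U e w.
Proof.
move=> lw Lw; apply/seteqP; split=> [w' [L' [x [lw' Lw' xY]]]|w' [lw' ww']].
  split=> //; apply/(lift_gcoset lw lw' Lw Lw').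
  by rewrite (gcoset_eq xY).
have [L' [x' Lw']] := loop_lift_exists lw'.
exists L', x'; split=> //; rewrite -(proj2 (lift_gcoset lw lw' Lw Lw') ww').
exact: gcoset_refl.
Qed.

Lemma pi1_lift A : pi1 A -> exists Y, Pt Y /\ lift_class A = gcoset Y Pt2.
Proof.
by have [+ _ _] := @lift_class_bij R m => /[apply] -[Y PY <-]; exists Y.
Qed.

Lemma lift_class_inj A B : pi1 A -> pi1 B -> lift_class A = lift_class B -> A = B.
Proof.
by move=> pA pB; have [_ + _] := @lift_class_bij R m; apply; apply: mem_set.
Qed.

Lemma lift_loops_over Y : Pt Y ->
  pi1 (loops_over Y) /\ lift_class (loops_over Y) = gcoset Y Pt2.
Proof.
move=> PY; have [w [L [lw Lw]]] := Pt_loop PY.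
rewrite (loops_overE lw Lw); split; first by exists w.
exact: lift_classE Lw.
Qed.

Lemma constant_lift : path_lift e (fun=> e) (fun=> 1%g : St) 1%g.
Proof.
split; [by exists 0|by move=> k; rewrite mulmx_theta1| |by exists 0].
by move=> k; rewrite mulVg; apply: local1.
Qed.

Lemma constant_loop : loop U e (fun=> e).
Proof.
split; [move=> k|by exists 0|by exists 0].
apply/(edgeP (@EUm_act R m)); split; first exact: EUm_e.
by exists finset.set0; split; [exact: nilpotent_set0|exact: near_refl].
Qed.

Lemma lift_class_base : lift_class (pbase pi1) = gcoset 1%g Pt2.
Proof. exact: lift_classE constant_loop constant_lift. Qed.

Lemma theta_block Y : Pt Y ->
  exists v t, (theta Y : 'M[R]_(1 + m)) = block_mx 1 0 v t.
Proof. by case=> PY _; apply: Pn_block. Qed.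

(** The factor u of [Pn_factor] lies in EPn2, so the corner of theta Y is in GLEP2
    exactly when theta Y is in EPn2, the image of Pt2. *)
Lemma corner_mem Y v t : (theta Y : 'M[R]_(1 + m)) = block_mx 1 0 v t ->
  GLEP2 t <-> exists p, Pt2 p /\ theta p = theta Y.
Proof.
have [E1 EM EV] := @EPn2_subgroup R m.
move=> /Pn_factor[u [Eu YE]]; rewrite /Defs.GLEP2 /= YE; split=> [Et|[p [Pp pE]]].
  have : EPn2 (embed t * u)%g by apply: EM.
  by rewrite -theta_Pt2 => -[p Pp pE]; exists p.
have -> : embed t = (theta p * u^-1)%g by rewrite pE mulgK.
by apply: (EM _ _ _ (EV _ Eu)); rewrite -theta_Pt2; exists p.
Qed.

Lemma corner_gcoset Y Y' v v' t t' : gcoset Y Pt2 = gcoset Y' Pt2 ->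
  (theta Y : 'M[R]_(1 + m)) = block_mx 1 0 v t ->
  (theta Y' : 'M[R]_(1 + m)) = block_mx 1 0 v' t' ->
  gcoset t GLEP2 = gcoset t' GLEP2.
Proof.
have [E1 EM EV] := @EPn2_subgroup R m.
move=> /(subgroup_gcoset _ _ (@Pt2_subgroup R m)) YY'.
move=> /Pn_factor[u [Eu YE]] /Pn_factor[u' [Eu' Y'E]].
apply/(subgroup_gcoset _ _ GLEP2_subgroup); rewrite /Defs.GLEP2 /=.
rewrite embedM embedV.
have -> : ((embed t)^-1 * embed t')%g = (u * theta (Y^-1 * Y') * u'^-1)%g.
  by rewrite thetaM thetaV YE Y'E invgM !mulgA mulgV mul1g mulgK.
apply: (EM _ _ _ (EV _ Eu')); apply: EM => //.
by rewrite -theta_Pt2; exists (Y^-1 * Y')%g.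
Qed.

Lemma corner_mapE Y v t A : Pt Y -> lift_class A = gcoset Y Pt2 ->
  (theta Y : 'M[R]_(1 + m)) = block_mx 1 0 v t ->
  corner_map A = gcoset t GLEP2.
Proof.
move=> PY AY YE; apply/seteqP; split=> s; last by exists Y, v, t.
move=> [Y' [v' [t' [PY' AY' Y'E]]]].
by rewrite (@corner_gcoset Y Y' v v' t t') // -AY -AY'.
Qed.

Lemma embed_mapE t : embed_map (gcoset t GLEP2) = gcoset (embed t) (En R m.+1).
Proof.
have [G1 GM _] := @En_subgroup R m.+1.
apply/seteqP; split=> [_ [[_ h] [/= [_ [s Es <-] <-] Eh] <-]|_ [h Eh <-]].
  rewrite embedM -mulgA; exists (embed s * h)%g => //; apply: GM => //.
  by have [_] := EPn2_sub_EPn Es.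
exists (embed t, h) => //; split=> //=; exists t => //.
by exists 1%g; [case: GLEP2_subgroup|rewrite mulg1].
Qed.

Lemma theta1_block : (theta 1%g : 'M[R]_(1 + m)) = block_mx 1 0 0 (1%g : GL R m).
Proof. by rewrite theta1 -embed1 embedE. Qed.

Lemma corner_map_base : corner_map (pbase pi1) = gcoset 1%g GLEP2.
Proof.
apply: (@corner_mapE 1%g 0) theta1_block; last exact: lift_class_base.
by case: (@Pt_subgroup R m).
Qed.

Lemma K2_Pt Y : K2 R m Y -> Pt Y.
Proof. by move=> Y1; apply/PtE; rewrite (Y1 : theta Y = 1%g) mulmx1. Qed.

Lemma second_sequence :
  [/\ pointed_map (K22 R m) (K2 R m) id,
      pointed_map (K2 R m) pi1 loops_over,
      pointed_map pi1 (K1_mod_K12 R m) corner_map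
    & pointed_map (K1_mod_K12 R m) (K1 R m.+1) embed_map] /\
  [/\ exact_at (K22 R m) (K2 R m) pi1 id loops_over,
      exact_at (K2 R m) pi1 (K1_mod_K12 R m) loops_over corner_map
    & exact_at pi1 (K1_mod_K12 R m) (K1 R m.+1) corner_map embed_map].
Proof.
have K2_base : K2 R m 1%g by exact: theta1.
have K22_base : K22 R m 1%g by split=> //; apply: Pt2_1.
have pi1_base : pi1 (pbase pi1) by exists (fun=> e) => //; apply: constant_loop.
have over1 : loops_over 1%g = pbase pi1.
  by apply: loops_overE constant_lift; apply: constant_loop.
split; split.
- by split=> // Y [].
- by split=> // Y /K2_Pt/lift_loops_over[].
- split=> //; [by exists 1%g| |exact: corner_map_base].
  move=> A /pi1_lift[Y [PY AY]]; have [v [t YE]] := theta_block PY.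
  by rewrite (corner_mapE PY AY YE); exists t.
- split=> //; [by exists 1%g|by exists 1%g| |].
    by move=> _ [t _ <-]; rewrite embed_mapE; exists (embed t).
  by rewrite /= embed_mapE embed1.
- move=> Y KY; have [pY lY] := lift_loops_over (K2_Pt KY).
  have P1 : gcoset 1%g Pt2 = gcoset Y Pt2 <-> Pt2 Y.
    by rewrite (subgroup_gcoset _ _ (@Pt2_subgroup R m)) invg1 mul1g.
  split=> [ee|[Z [[_ PZ] ZY]]].
    by exists Y; split=> //; split=> //; apply/P1; rewrite -lY ee lift_class_base.
  apply: lift_class_inj => //; rewrite lY lift_class_base; apply/esym/P1.
  by rewrite -ZY.
- move=> A pA; have [Y [PY AY]] := pi1_lift pA.
  have [v [t YE]] := theta_block PY.
  rewrite (corner_mapE PY AY YE) /=.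
  have -> : gcoset t GLEP2 = gcoset 1%g GLEP2 <-> GLEP2 t.
    split=> [ee|Et]; last first.
      apply/esym/(subgroup_gcoset _ _ GLEP2_subgroup).
      by rewrite invg1 mul1g.
    by move/esym/(subgroup_gcoset _ _ GLEP2_subgroup): ee; rewrite invg1 mul1g.
  rewrite (corner_mem YE); split=> [[p [Pp pE]]|[Z [KZ ZA]]].
    exists (Y * p^-1)%g.
    have KZ : K2 R m (Y * p^-1)%g.
      by rewrite -[K2 R m _]/(theta _ = 1%g) thetaM thetaV pE mulgV.
    split=> //; have [pZ lZ] := lift_loops_over (K2_Pt KZ).
    apply: lift_class_inj => //; rewrite lZ AY.
    apply/(subgroup_gcoset _ _ (@Pt2_subgroup R m)).
    by rewrite invgM invgK mulgVK.
  have [pZ lZ] := lift_loops_over (K2_Pt KZ).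
  have : gcoset Z Pt2 = gcoset Y Pt2 by rewrite -lZ ZA AY.
  move=> /(subgroup_gcoset _ _ (@Pt2_subgroup R m)) ZY.
  exists (Z^-1 * Y)%g; split=> //.
  by rewrite thetaM thetaV (KZ : theta Z = 1%g) invg1 mul1g.
move=> _ [t _ <-]; rewrite embed_mapE /=.
have GE := @En_subgroup R m.+1.
have -> : gcoset (embed t) (En R m.+1) = gcoset 1%g (En R m.+1) <-> En R m.+1 (embed t).
  split=> [ee|Et]; last first.
    by apply/esym/(subgroup_gcoset _ _ GE); rewrite invg1 mul1g.
  by move/esym/(subgroup_gcoset _ _ GE): ee; rewrite invg1 mul1g.
split=> [|[A [pA At]]].
  rewrite -theta_En => -[Y _ YE].
  have YB : (theta Y : 'M[R]_(1 + m)) = block_mx 1 0 0 t by rewrite YE embedE.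
  have PY : Pt Y by split; [apply: Pn_of_block YB|apply: En_theta].
  have [pY lY] := lift_loops_over PY.
  by exists (loops_over Y); split=> //; apply: corner_mapE YB.
have [Y [PY AY]] := pi1_lift pA; have [v [s YE]] := theta_block PY.
move: At; rewrite (corner_mapE PY AY YE).
move=> /(subgroup_gcoset _ _ GLEP2_subgroup) st.
have [u [Eu Yu]] := Pn_factor YE.
have [_ EM EV] := GE.
have sub x : EPn2 x -> En R m.+1 x by move=> /EPn2_sub_EPn[].
have -> : embed t = (theta Y * u^-1 * embed (s^-1 * t))%g.
  by rewrite Yu mulgK embedM embedV mulVKg.
by apply: (EM _ _ _ (sub _ st)); apply: (EM _ _ _ (EV _ (sub _ Eu))); apply: En_theta.
Qed.

End SecondSequence.

(* Here n = m.+1. *)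
Theorem proposition5p1 (R : pzRingType) (m : nat) (hn : (3 <= m.+1)%N) :
  (exists (alpha : set (GL R m.+1) -> set 'rV[R]_m.+1)
          (beta : set 'rV[R]_m.+1 -> module_class R)
          (gamma : module_class R -> module_class R),
    [/\ forall s : GL R m.+1,
          alpha (gcoset s (En R m.+1)) = pi0_class (Um R m.+1) (e1row R m *m s),
        forall v : 'rV[R]_m.+1, Um R m.+1 v ->
          beta (pi0_class (Um R m.+1) v) = iso_class (ker_row v)
      & forall M : lmodType R^c, K0s_module m M ->
          gamma (iso_class M) = iso_class (M * (R^c)^o)%type]
    /\ [/\ pointed_map (K1 R m.+1) (pi0 (Um R m.+1) (e1row R m)) alpha,
           pointed_map (pi0 (Um R m.+1) (e1row R m)) (K0s R m) beta
         & pointed_map (K0s R m) (K0s R m.+1) gamma]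
    /\ exact_at (K1 R m.+1) (pi0 (Um R m.+1) (e1row R m)) (K0s R m) alpha beta
    /\ exact_at (pi0 (Um R m.+1) (e1row R m)) (K0s R m) (K0s R m.+1) beta gamma)
  /\
  (exists Phi : set (int -> 'rV[R]_m.+1) -> set (St R m.+1),
    (* the identification of pi_1 with Pt / Pt2 by path lifting *)
    [/\ set_bij (pi1 (EUm R m) (e1row R m)) (Pt_quot R m) Phi,
        forall A B, pi1 (EUm R m) (e1row R m) A -> pi1 (EUm R m) (e1row R m) B ->
          Phi (pi1_mul (EUm R m) (e1row R m) A B) = setprod (Phi A) (Phi B)
      & forall (w : int -> 'rV[R]_m.+1) (xs : seq (St R m.+1)),
          loop (EUm R m) (e1row R m) w -> lifts w xs ->
          Phi (loop_class (EUm R m) (e1row R m) w)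
            = gcoset (\prod_(x <- xs) x)%g (Pt2 R m)]
    /\
    exists (delta : St R m.+1 -> St R m.+1)
           (eta : St R m.+1 -> set (int -> 'rV[R]_m.+1))
           (mu : set (int -> 'rV[R]_m.+1) -> set (GL R m))
           (lambda : set (GL R m) -> set (GL R m.+1)),
    [/\ forall Y, K22 R m Y -> delta Y = Y,
        forall Y, K2 R m Y -> Phi (eta Y) = gcoset Y (Pt2 R m),
        forall Y A, Pt R m Y -> pi1 (EUm R m) (e1row R m) A ->
          Phi A = gcoset Y (Pt2 R m) ->
          exists (v : 'cV[R]_m) (t : GL R m),
            (theta Y : 'M[R]_(1 + m)) = block_mx 1 0 v t
            /\ mu A = gcoset t (GLEP2 R m)
      & forall t : GL R m,
          lambda (gcoset t (GLEP2 R m)) = gcoset (embed t) (En R m.+1)]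
    /\ [/\ pointed_map (K22 R m) (K2 R m) delta,
           pointed_map (K2 R m) (pi1 (EUm R m) (e1row R m)) eta,
           pointed_map (pi1 (EUm R m) (e1row R m)) (K1_mod_K12 R m) mu
         & pointed_map (K1_mod_K12 R m) (K1 R m.+1) lambda]
    /\ [/\ exact_at (K22 R m) (K2 R m) (pi1 (EUm R m) (e1row R m)) delta eta,
           exact_at (K2 R m) (pi1 (EUm R m) (e1row R m)) (K1_mod_K12 R m) eta mu
         & exact_at (pi1 (EUm R m) (e1row R m)) (K1_mod_K12 R m) (K1 R m.+1)
             mu lambda]).
Proof.
have [pa pb pc ea eb] := first_sequence R m.
have [[pd pe pm pl] [ed ee em]] := second_sequence R m.
split.
  exists (@orbit_map R m), (@kernel_map R m), (@stabilization_map R).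
  split; last by [].
  split=> [s|v Uv|M _]; first exact: orbit_mapE.
    exact: kernel_mapE.
  exact: stabilization_mapE.
exists (@lift_class R m); split.
  split; [exact: lift_class_bij|exact: lift_class_mul|].
  move=> w xs lw /lifts_path_lift[L Lw]; exact: lift_classE Lw.
exists id, (@loops_over R m), (@corner_map R m), (@embed_map R m).
split; last by split.
split=> // [Y KY|Y A PY pA AY|t]; last exact: embed_mapE.
  by case: (lift_loops_over (K2_Pt KY)).
have [v [t YE]] := theta_block PY.
by exists v, t; split=> //; apply: corner_mapE YE.
Qed.
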